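(* Let $k\geq 1$ be an integer and let $\ell\geq 5$ be a prime. Suppose there are positive integers $h,t$ with $k+h=\ell t$ such that at least one of the following holds: (1) $h\in\{4,8,14\}$ and $\ell\equiv 2\pmod 3$; (2) $h\in\{6,10\}$ and $\ell\equiv 3\pmod 4$; (3) $h=26$ and $\ell\equiv 11\pmod{12}$. Let $\delta_{k,\ell}\in\{0,1,\dots,\ell-1\}$ be the integer with $24\,\delta_{k,\ell}\equiv k\pmod{\ell}$. (Under these hypotheses it is known that $p_k(\ell n+\delta_{k,\ell})\equiv 0\pmod \ell$ for all $n\ge 0$, where $p_k$ is the $k$-colored partition function.) Assume moreover that both of the following hold: (i) there is no odd prime $p\equiv 2\pmod 3$ with $p\mid (k+14)$, or $\ell\not\equiv 2\pmod 3$, or $\ell\nmid (k+8)$; (ii) $\ell\not\equiv 11\pmod{12}$ or $\ell\nmid (k+26)$. Then for every integer $n\geq 0$, $$\Phi_{\ell}(\zeta)\;\Big|\;\big[q^{\ell n+\delta_{k,\ell}}\big]\,\mathcal{C}_k(z;\tau)$$ as Laurent polynomials in $\zeta$.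
   Context: Here $q=e^{2\pi i\tau}$ and $\zeta=e^{2\pi i z}$ (they may be treated as formal variables); $[q^m]F$ denotes the coefficient of $q^m$ in the $q$-expansion of $F$ (here a Laurent polynomial in $\zeta$); $\Phi_\ell(X)=1+X+\cdots+X^{\ell-1}$ is the $\ell$-th cyclotomic polynomial. The $k$-colored partition function $p_k(n)$ is defined by $\sum_{n\ge0}p_k(n)q^n=\prod_{n\ge1}(1-q^n)^{-k}$. The crank generating function is $$\mathcal{C}(z;\tau)=\prod_{n\ge1}\frac{1-q^n}{(1-\zeta q^n)(1-\zeta^{-1}q^n)}.$$ Let $\delta_{\mathrm{odd}}(k)=(1-(-1)^k)/2$, so it is $1$ for $k$ odd and $0$ for $k$ even. Put $$\mathcal{C}_k\big(z_1,\dots,z_{\frac{k+\delta_{\mathrm{odd}}(k)}2};\tau\big)=\mathcal{C}(0;\tau)^{\frac{k-\delta_{\mathrm{odd}}(k)}2}\prod_{i=1}^{\frac{k+\delta_{\mathrm{odd}}(k)}2}\mathcal{C}(z_i;\tau).$$ The one-variable function $\mathcal{C}_k(z;\tau)$ is defined as follows. If $k+14$ is not divisible by any odd prime $p\equiv2\pmod3$, then $$\mathcal{C}_k(z;\tau)=\mathcal{C}_k\big(kz,(k-2)z,(k-4)z,\dots,(2-\delta_{\mathrm{odd}}(k))z;\tau\big).$$ If $k+14$ is divisible by some odd prime $p\equiv2\pmod3$, then $$\mathcal{C}_k(z;\tau)=\mathcal{C}_k\big((k+2)z,(k-2)z,(k-4)z,\dots,(2-\delta_{\mathrm{odd}}(k))z;\tau\big),$$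 i.e. the first argument $kz$ is replaced by $(k+2)z$ and all the others are kept. Equivalently, with $a_1,\dots,a_{(k+\delta_{\mathrm{odd}}(k))/2}$ the integer multipliers of $z$ in the arguments, $$\mathcal{C}_k(z;\tau)=\prod_{n\ge1}\frac{1-\delta_{\mathrm{odd}}(k)q^n}{\prod_i(1-\zeta^{a_i}q^n)(1-\zeta^{-a_i}q^n)}.$$ *)

(* Defs.v *)
From HB Require Import structures.
From mathcomp Require Import all_boot all_order all_algebra.
From mathcomp Require Import boolp.

Set Implicit Arguments.
Unset Strict Implicit.
Unset Printing Implicit Defensive.

Import GRing.Theory.
Local Open Scope ring_scope.

(* Formal power series in one variable q over a commutative unit ring, with  *)
(* the Cauchy product; the units are the series with a unit constant term.   *)

Record fps (R : Type) := FPS { fps_coef : nat -> R }.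
Arguments FPS {R} _.
Arguments fps_coef {R} _ _.

HB.instance Definition _ (R : Type) := gen_eqMixin (fps R).
HB.instance Definition _ (R : Type) := gen_choiceMixin (fps R).

Lemma fpsP (R : Type) (f g : fps R) :
  (forall m, fps_coef f m = fps_coef g m) -> f = g.
Proof. by case: f g => [f] [g] /= fg; congr FPS; apply: funext. Qed.

Section FpsRing.
Variable R : comUnitRingType.
Implicit Types f g h : fps R.

Definition fps_zero : fps R := FPS (fun=> 0).
Definition fps_opp f : fps R := FPS (fun m => - fps_coef f m).
Definition fps_add f g : fps R := FPS (fun m => fps_coef f m + fps_coef g m).
Definition fps_const (c : R) : fps R := FPS (fun m => c *+ (m == 0)%N).
Definition fps_mul f g : fps R :=
  FPS (fun m => \sum_(i < m.+1) fps_coef f i * fps_coef g (m - i)%N).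

Fact fps_addA : associative fps_add.
Proof. by move=> f g h; apply: fpsP => m /=; rewrite addrA. Qed.
Fact fps_addC : commutative fps_add.
Proof. by move=> f g; apply: fpsP => m /=; rewrite addrC. Qed.
Fact fps_add0 : left_id fps_zero fps_add.
Proof. by move=> f; apply: fpsP => m /=; rewrite add0r. Qed.
Fact fps_addN : left_inverse fps_zero fps_opp fps_add.
Proof. by move=> f; apply: fpsP => m /=; rewrite addNr. Qed.

HB.instance Definition _ :=
  GRing.isZmodule.Build (fps R) fps_addA fps_addC fps_add0 fps_addN.

Let trunc n f : {poly R} := \poly_(i < n) fps_coef f i.

Let coef_mul_trunc n f g m : (m < n)%N ->
  fps_coef (fps_mul f g) m = (trunc n f * trunc n g)`_m.
Proof.
move=> lt_mn; rewrite coefM; apply: eq_bigr => i _.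
by rewrite !coef_poly !(leq_ltn_trans _ lt_mn) ?leq_subr // -ltnS.
Qed.

Fact fps_mulC : commutative fps_mul.
Proof.
by move=> f g; apply: fpsP => m; rewrite !(@coef_mul_trunc m.+1) // mulrC.
Qed.

Fact fps_mulA : associative fps_mul.
Proof.
have mul3 f g h m : fps_coef (fps_mul (fps_mul f g) h) m =
    (trunc m.+1 f * trunc m.+1 g * trunc m.+1 h)`_m.
  rewrite coefM; apply: eq_bigr => i _.
  by rewrite (@coef_mul_trunc m.+1) // [in RHS]coef_poly ltnS leq_subr.
move=> f g h; apply: fpsP => m.
by rewrite fps_mulC !mul3 mulrC mulrA.
Qed.

Fact fps_mul1 : left_id (fps_const 1) fps_mul.
Proof.
move=> f; apply: fpsP => m /=; rewrite big_ord_recl /= mul1r subn0.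
by rewrite big1 ?addr0 // => i _; rewrite mulr0n mul0r.
Qed.

Fact fps_mulDl : left_distributive fps_mul fps_add.
Proof.
move=> f g h; apply: fpsP => m /=; rewrite -big_split /=.
by apply: eq_bigr => i _; rewrite mulrDl.
Qed.

Fact fps_one_neq0 : fps_const 1 != 0.
Proof.
by apply/eqP => /(congr1 (fun f => fps_coef f 0%N)) /= /eqP; rewrite oner_eq0.
Qed.

HB.instance Definition _ := GRing.Zmodule_isComNzRing.Build (fps R)
  fps_mulA fps_mulC fps_mul1 fps_mulDl fps_one_neq0.

Lemma fps_coefM f g m :
  fps_coef (f * g) m = \sum_(i < m.+1) fps_coef f i * fps_coef g (m - i)%N.
Proof. by []. Qed.

(* The first n coefficients of f^-1, from the recursion expressing that the  *)
(* m-th coefficient of f^-1 * f is [m = 0].                                  *)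
Fixpoint fps_inv_seq f n : seq R :=
  if n is m.+1 then
    let s := fps_inv_seq f m in
    rcons s ((fps_coef f 0%N)^-1 *
             ((m == 0)%N%:R - \sum_(i < m) s`_i * fps_coef f (m - i)%N))
  else [::].

Definition fps_unit : pred (fps R) := fun f => fps_coef f 0%N \is a GRing.unit.
Definition fps_inv f : fps R :=
  if fps_unit f then FPS (fun m => (fps_inv_seq f m.+1)`_m) else f.

Let size_inv_seq f n : size (fps_inv_seq f n) = n.
Proof. by elim: n => //= n IHn; rewrite size_rcons IHn. Qed.

Let nth_inv_seq f n i : (i < n)%N ->
  (fps_inv_seq f n)`_i = (fps_inv_seq f i.+1)`_i.
Proof.
elim: n => // n IHn; rewrite ltnS leq_eqVlt => /orP[/eqP-> // | lt_in].
by rewrite -IHn // {1}/fps_inv_seq -/fps_inv_seq nth_rcons size_inv_seq lt_in.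
Qed.

Fact fps_mulV : {in fps_unit, left_inverse 1 fps_inv *%R}.
Proof.
move=> f f_unit; have f0_unit : fps_coef f 0%N \is a GRing.unit by [].
apply: fpsP => m; rewrite fps_coefM big_ord_recr /= subnn.
rewrite /fps_inv ifT //= nth_rcons size_inv_seq ltnn eqxx.
rewrite mulrAC mulVr // mul1r addrC.
rewrite [X in _ + X](_ : _ = \sum_(i < m) (fps_inv_seq f m)`_i *
    fps_coef f (m - i)%N) ?subrK //.
by apply: eq_bigr => i _; rewrite [in RHS]nth_inv_seq.
Qed.

Fact fps_unitPl f g : g * f = 1 -> fps_unit f.
Proof.
move/(congr1 (fun f => fps_coef f 0%N)); rewrite fps_coefM big_ord1 /= => gf1.
by apply/unitrP; exists (fps_coef g 0%N); split; rewrite // mulrC.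
Qed.

Fact fps_inv_out : {in [predC fps_unit], fps_inv =1 id}.
Proof. by move=> f; rewrite inE /fps_inv => /negPf; rewrite /in_mem /= => ->. Qed.

HB.instance Definition _ := GRing.ComNzRing_hasMulInverse.Build (fps R)
  fps_mulV fps_unitPl fps_inv_out.

Definition fps_q : fps R := FPS (fun m => (m == 1)%N%:R).

(* The infinite product of F 1, F 2, ...; it is meaningful when              *)
(* F n = 1 + O(q^n), so that the factors with n > m do not contribute to the *)
(* coefficient of q^m (see coef_fps_infprod).                                *)
Definition fps_infprod (F : nat -> fps R) : fps R :=
  FPS (fun m => fps_coef (\prod_(1 <= n < m.+1) F n) m).

Lemma coef_fps_infprod (F : nat -> fps R) m N :
  (forall n i, (i < n)%N -> fps_coef (F n) i = (i == 0)%N%:R) -> (m <= N)%N ->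
  fps_coef (fps_infprod F) m = fps_coef (\prod_(1 <= n < N.+1) F n) m.
Proof.
move=> F1; elim: N => [|N IHN]; first by rewrite leqn0 => /eqP->.
rewrite leq_eqVlt => /orP[/eqP-> // | lt_mN]; rewrite IHN //.
rewrite [in RHS]big_nat_recr // [in RHS]fps_coefM big_ord_recr /= subnn.
rewrite F1 // mulr1 [X in _ = X + _]big1 ?add0r // => i _.
rewrite F1 ?ltnS ?(leq_trans (leq_subr _ _)) //.
by rewrite subn_eq0 leqNgt ltn_ord mulr0.
Qed.

Lemma coef_fps_inv_small f n :
  (forall i, (i < n)%N -> fps_coef f i = (i == 0)%N%:R) ->
  forall i, (i < n)%N -> fps_coef f^-1 i = (i == 0)%N%:R.
Proof.
move=> f1 i lt_in.
have f_unit : f \is a GRing.unit.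
  rewrite [_ \is a _](_ : _ = (fps_coef f 0%N \is a GRing.unit)) //.
  by rewrite f1 ?unitr1 // (leq_ltn_trans _ lt_in).
have := congr1 (fun g => fps_coef g i) (mulVr f_unit).
rewrite fps_coefM big_ord_recr /= subnn f1 ?(leq_ltn_trans _ lt_in) // mulr1.
rewrite [X in X + _]big1 ?add0r // => j _.
rewrite f1 ?(leq_ltn_trans (leq_subr _ _)) //.
by rewrite subn_eq0 leqNgt ltn_ord mulr0.
Qed.

Lemma coef_fps_mul_small f g n :
  (forall i, (i < n)%N -> fps_coef f i = (i == 0)%N%:R) ->
  (forall i, (i < n)%N -> fps_coef g i = (i == 0)%N%:R) ->
  forall i, (i < n)%N -> fps_coef (f * g) i = (i == 0)%N%:R.
Proof.
move=> f1 g1 i lt_in; rewrite fps_coefM big_ord_recl subn0 f1 ?g1 //=; last first.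
  exact: leq_ltn_trans lt_in.
rewrite mul1r big1 ?addr0 // => j _; rewrite f1 ?mul0r //.
exact: leq_ltn_trans (ltn_ord j) lt_in.
Qed.

Lemma coef_fps_qX n i : fps_coef (fps_q ^+ n) i = (i == n)%:R.
Proof.
elim: n i => [|n IHn] [|i] //; rewrite exprS fps_coefM.
  by rewrite big_ord1 mul0r.
rewrite big_ord_recl big_ord_recl /= mul0r add0r mul1r subn1 IHn.
by rewrite big1 ?addr0 // => j _; rewrite mul0r.
Qed.

Lemma coef_fps_constM c f i : fps_coef (fps_const c * f) i = c * fps_coef f i.
Proof.
rewrite fps_coefM big_ord_recl /= mulr1n subn0 big1 ?addr0 // => j _.
by rewrite mulr0n mul0r.
Qed.

Lemma coef_fps_1sub_small c n i : (i < n)%N ->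
  fps_coef (1 - fps_const c * fps_q ^+ n) i = (i == 0)%N%:R.
Proof.
move=> lt_in.
rewrite /= [X in _ - X](coef_fps_constM c (fps_q ^+ n) i) coef_fps_qX.
by rewrite (ltn_eqF lt_in) mulr0 subr0.
Qed.

End FpsRing.

(* Laurent polynomials over Z in zeta, realised as the subring Z[zeta^{+-1}] *)
(* of the field of fractions of Z[zeta].                                     *)

Definition ratfun : fieldType := {fraction {poly int}}.

Definition zeta : ratfun := tofrac ('X : {poly int}).

Definition is_laurent (f : ratfun) : Prop :=
  exists (p : {poly int}) (n : nat), f = tofrac p / zeta ^+ n.

Definition laurent_dvd (f g : ratfun) : Prop :=
  exists2 h, is_laurent h & g = f * h.

Definition Phi (l : nat) (x : ratfun) : ratfun := \sum_(i < l) x ^+ i.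

Local Notation q := (fps_q ratfun).

Definition crank_factor (a : int) (n : nat) : fps ratfun :=
  (1 - q ^+ n) /
  ((1 - fps_const (zeta ^ a) * q ^+ n) *
   (1 - fps_const (zeta ^ (- a)) * q ^+ n)).

Lemma coef_crank_factor_small (a : int) (n i : nat) : (i < n)%N ->
  fps_coef (crank_factor a n) i = (i == 0)%N%:R.
Proof.
have q1 j : (j < n)%N -> fps_coef (1 - q ^+ n) j = (j == 0)%N%:R.
  by rewrite -[q ^+ n]mul1r; apply: coef_fps_1sub_small.
move: i; apply: coef_fps_mul_small => //; apply: coef_fps_inv_small.
by apply: coef_fps_mul_small; apply: coef_fps_1sub_small.
Qed.

(* C(a z; tau), where the integer a acts through zeta |-> zeta^a. *)
Definition crank (a : int) : fps ratfun := fps_infprod (crank_factor a).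

(* C_k(a_0 z, a_1 z, ...; tau): the boolean odd k, as a natural number, is    *)
(* delta_odd k.                                                               *)
Definition crank_multi (k : nat) (a : nat -> int) : fps ratfun :=
  crank 0 ^+ ((k - odd k)./2%N) * \prod_(i < (k + odd k)./2%N) crank (a i).

Definition has_odd_prime_2mod3 (m : nat) : bool :=
  has (fun p => odd p && (p %% 3 == 2)%N) (primes m).

(* The i-th multiplier of z, from i = 0: k, k - 2, ..., 2 - delta_odd k, with *)
(* the leading k replaced by k + 2 in the exceptional case.                  *)
Definition crank_mult (k i : nat) : int :=
  if (i == 0)%N && has_odd_prime_2mod3 (k + 14)%N then k%:Z + 2
  else k%:Z - (2 * i)%N%:Z.

Definition crank_k (k : nat) : fps ratfun := crank_multi k (crank_mult k).

(* Main.v *)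
Require Import Defs.
From HB Require Import structures.
From mathcomp Require Import all_boot all_order all_algebra.
From mathcomp Require Import finfield algC cyclotomic.
From mathcomp Require Import boolp classical_sets fsbigop.
From mathcomp Require Import zify ring.

(** It suffices to show that the coefficient vanishes when zeta is replaced by any
    primitive l-th root of unity w: there are l - 1 of them, and Phi_l has degree
    l - 1 (Phi_dvd; the specialization is the relation evaluates).

    Write E for the product of 1 - q^n and W(x) for that of 1 - x q^n. At w, the
    crank with the regular multipliers is E divided by the W(w^j), for
    j = k, k - 2, ..., -k. As k = - h modulo l, these k + 1 exponents miss only
    h - 1 terms of an arithmetic progression that runs t times through all the
    residue classes, and over such a full progression the product of the W(w^j)
    is a series in q^l (progression_full, progression_complement). Up to a series in q^l, which does not mix the
    exponents of different classes modulo l (lacunary_quotient), the crank is thus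
    E^2 times the product of the W(x^i) W(x^-i), where x = w^2 and i runs over
    1, ..., h/2 - 1 (crank_standard). In the exceptional case, h/2 - 1 is replaced
    by h/2 (crank_exceptional).

    For h = 4 and 6 this is a product of two unary theta series. For h = 8, 10 and
    14 it is a Macdonald product of type A2, B2 and G2; in type G2 this holds only
    for the exceptional multipliers 1, 2, 3, 4, 5, 7, and indeed the case h = 14 is
    always exceptional; as x^5 = 1 for l = 5, that prime is moved to h = 4 when h
    is 14. For h = 8 the exceptional multipliers are excluded by condition (i), and h = 26 is excluded by condition (ii). In all cases the block
    is, up to a constant, a sum over a lattice of rank two of signed monomials in
    roots of unity times q^m, in which 24m + h is proportional to a form
    a^2 - ab + b^2 or a^2 + b^2. The congruence on l makes this form anisotropic
    modulo l. If l divides 24m + h, which holds for m = ln + delta, then a and b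
    are multiples of l, the monomials become constant, and an involution
    of the lattice that changes the signs shows that the sum is 0 (coef_a2, coef_b2,
    coef_g2, coef_theta_theta, coef_euler_theta).

    The Macdonald identities are derived from the Jacobi triple product alone.
    Expanding a product of theta series and collecting a monomial, one is left
    with sums of one variable that are recentred pentagonal sums, that is, E up to
    a sign and a power of q (pent_shift); this gives A2 and B2. The G2 product is
    a product of two A2 products, and the remaining double sum is evaluated by the
    A2 identity in base q^4 (g2_inner_sum). *)

Set Implicit Arguments.
Unset Strict Implicit.
Unset Printing Implicit Defensive.

Import Order.TTheory GRing.Theory Num.Theory.
Local Open Scope ring_scope.
#[local] Arguments fps_coef {R} _ _ : simpl never.

(** * Infinite sums of power series *)

Section InfiniteSums.
Variable R : comUnitRingType.
Implicit Types (I J : choiceType) (g : fps R).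

Lemma fps_coefD f g m : fps_coef (f + g : fps R) m = fps_coef f m + fps_coef g m.
Proof. by []. Qed.

Lemma fps_coefN f m : fps_coef (- f : fps R) m = - fps_coef f m.
Proof. by []. Qed.

Lemma fps_coef1 m : fps_coef (1 : fps R) m = (m == 0)%N%:R.
Proof. by []. Qed.

Lemma fps_coef_sum (J : Type) (r : seq J) (P : pred J) (F : J -> fps R) m :
  fps_coef (\sum_(j <- r | P j) F j) m = \sum_(j <- r | P j) fps_coef (F j) m.
Proof. by elim/big_rec2: _ => // j x y _ <-. Qed.

(** In each degree a finite sequence covers the indices that contribute. It may
    contain superfluous indices, so that sums, products and changes of indices
    only have to transport covers. *)
Definition summable I (f : I -> fps R) : Prop :=
  forall m, exists s : seq I, forall i, i \notin s -> fps_coef (f i) m = 0.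

Definition psum I (f : I -> fps R) : fps R :=
  FPS (fun m => \sum_(i \in [set: I]%classic) fps_coef (f i) m).

Lemma coef_psum I (f : I -> fps R) m (s : seq I) : uniq s ->
  (forall i, i \notin s -> fps_coef (f i) m = 0) ->
  fps_coef (psum f) m = \sum_(i <- s) fps_coef (f i) m.
Proof.
move=> uniq_s cover_s; rewrite fsbig_seq //=.
apply/esym/fsbig_widen => // i [_ /= /negP]; exact: cover_s.
Qed.

Lemma coef_psum0 I (f : I -> fps R) m :
  (forall i, fps_coef (f i) m = 0) -> fps_coef (psum f) m = 0.
Proof. by move=> f0; rewrite (@coef_psum _ _ _ [::]) ?big_nil. Qed.

Lemma eq_psum I (f g : I -> fps R) : f =1 g -> psum f = psum g.
Proof. by move=> /funext->. Qed.

Lemma summable_uniq I (f : I -> fps R) m : summable f ->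
  exists s : seq I, uniq s /\ forall i, i \notin s -> fps_coef (f i) m = 0.
Proof.
move=> /(_ m)[s s_cover]; exists (undup s); split; first exact: undup_uniq.
by move=> i; rewrite mem_undup; apply: s_cover.
Qed.

Lemma summable_upto I (f : I -> fps R) m : summable f ->
  exists s : seq I, uniq s /\
    forall i j, i \notin s -> (j <= m)%N -> fps_coef (f i) j = 0.
Proof.
move=> sum_f; elim: m => [|m [s [_ s_cover]]].
  have [s [uniq_s s_cover]] := summable_uniq 0%N sum_f.
  by exists s; split=> // i j /s_cover fi0; rewrite leqn0 => /eqP->.
have [r r_cover] := sum_f m.+1; exists (undup (s ++ r)); split.
  exact: undup_uniq.
move=> i j; rewrite mem_undup mem_cat negb_or => /andP[i_s i_r].
by rewrite leq_eqVlt => /predU1P[->|/(s_cover i)->//]; apply: r_cover.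
Qed.

Lemma summable_reindex I J (h : J -> I) (f : I -> fps R) :
  bijective h -> summable f -> summable (f \o h).
Proof.
case=> h' hK h'K sum_f m; have [s s_cover] := sum_f m.
exists (map h' s) => j j_notin /=; apply: s_cover; apply: contra j_notin => hj.
by rewrite -[j]hK map_f.
Qed.

Lemma psum_reindex I J (h : J -> I) (f : I -> fps R) :
  bijective h -> psum f = psum (f \o h).
Proof. by move=> bij_h; apply: fpsP => m; apply: reindex_fsbigT. Qed.

Lemma coef_mul_uncovered I J (f : I -> fps R) (g : J -> fps R) m s r :
  (forall i j, i \notin s -> (j <= m)%N -> fps_coef (f i) j = 0) ->
  (forall i j, i \notin r -> (j <= m)%N -> fps_coef (g i) j = 0) ->
  forall p, p \notin [seq (i, j) | i <- s, j <- r] ->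
  fps_coef (f p.1 * g p.2) m = 0.
Proof.
move=> s_cover r_cover [i j] ij_notin; rewrite fps_coefM big1 // => a _.
have le_am : (a <= m)%N by rewrite -ltnS.
have [i_s | /s_cover->//] := boolP (i \in s); last by rewrite mul0r.
have [j_r | /r_cover->] := boolP (j \in r); rewrite ?mulr0 ?leq_subr //.
by case/negP: ij_notin; apply/allpairsP; exists (i, j).
Qed.

Lemma summableM I J (f : I -> fps R) (g : J -> fps R) :
  summable f -> summable g -> summable (fun p : I * J => f p.1 * g p.2).
Proof.
move=> sum_f sum_g m.
have [s [_ s_cover]] := summable_upto m sum_f.
have [r [_ r_cover]] := summable_upto m sum_g.
by exists [seq (i, j) | i <- s, j <- r]; apply: coef_mul_uncovered.
Qed.

(** A product of sums is a sum over pairs, without any further convergence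
    condition: this is what produces all the multiple sums below. *)
Lemma psumM I J (f : I -> fps R) (g : J -> fps R) :
  summable f -> summable g ->
  psum f * psum g = psum (fun p : I * J => f p.1 * g p.2).
Proof.
move=> sum_f sum_g; apply: fpsP => m; rewrite fps_coefM.
have [s [uniq_s s_cover]] := summable_upto m sum_f.
have [r [uniq_r r_cover]] := summable_upto m sum_g.
rewrite (@coef_psum _ _ _ [seq (i, j) | i <- s, j <- r]); first last.
- exact: coef_mul_uncovered.
- by rewrite allpairs_uniq // => -[? ?] [? ?].
rewrite big_allpairs /=.
transitivity (\sum_(a < m.+1) \sum_(i <- s) \sum_(j <- r)
    fps_coef (f i) a * fps_coef (g j) (m - a)%N).
  apply: eq_bigr => a _; have le_am : (a <= m)%N by rewrite -ltnS.
  rewrite (@coef_psum _ f _ s) // ?(@coef_psum _ g _ r) //.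
  - by rewrite mulr_suml; apply: eq_bigr => i _; rewrite mulr_sumr.
  - by move=> i i_r; rewrite r_cover // leq_subr.
  - by move=> i i_s; rewrite s_cover.
rewrite exchange_big /=; apply: eq_bigr => i _.
by rewrite exchange_big /=; apply: eq_bigr => j _; rewrite fps_coefM.
Qed.

Lemma summableMr I (f : I -> fps R) g :
  summable f -> summable (fun i => f i * g).
Proof.
move=> sum_f m; have [s [_ s_cover]] := summable_upto m sum_f.
exists s => i i_s; rewrite fps_coefM big1 // => a _.
by rewrite s_cover ?mul0r // -ltnS.
Qed.

Lemma summableMl I (f : I -> fps R) g :
  summable f -> summable (fun i => g * f i).
Proof. by move/(@summableMr _ _ g); under eq_fun do rewrite mulrC. Qed.

Lemma psumMr I (f : I -> fps R) g :
  summable f -> psum (fun i => f i * g) = psum f * g.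
Proof.
move=> sum_f; apply: fpsP => m; rewrite fps_coefM.
have [s [uniq_s s_cover]] := summable_upto m sum_f.
rewrite (@coef_psum _ _ _ s) //; last first.
  move=> i i_s; rewrite fps_coefM big1 // => a _.
  by rewrite s_cover ?mul0r // -ltnS.
under eq_bigr do rewrite fps_coefM.
rewrite exchange_big /=; apply: eq_bigr => a _; rewrite -mulr_suml.
by rewrite (@coef_psum _ f _ s) // => i i_s; rewrite s_cover // -ltnS.
Qed.

Lemma psumMl I (f : I -> fps R) g :
  summable f -> psum (fun i => g * f i) = g * psum f.
Proof.
by move=> sum_f; rewrite mulrC -psumMr //; apply: eq_psum => i; rewrite mulrC.
Qed.

(** Fubini: the covering sets of a double family, projected on the two
    indices, cover the iterated sums. *)
Lemma psum_pair I J (f : I * J -> fps R) : summable f ->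
  psum f = psum (fun i => psum (fun j => f (i, j))).
Proof.
move=> sum_f; apply: fpsP => m; have [s s_cover] := sum_f m.
pose s1 := undup (unzip1 s); pose s2 := undup (unzip2 s).
have s1_cover i j : i \notin s1 -> fps_coef (f (i, j)) m = 0.
  rewrite mem_undup => i_s; apply: s_cover; apply: contra i_s.
  exact: (map_f fst).
have s2_cover i j : j \notin s2 -> fps_coef (f (i, j)) m = 0.
  rewrite mem_undup => j_s; apply: s_cover; apply: contra j_s.
  exact: (map_f snd).
rewrite (@coef_psum _ f _ [seq (i, j) | i <- s1, j <- s2]); first last.
- move=> [i j] ij_notin; have [i_s|/s1_cover//] := boolP (i \in s1).
  have [j_s|/s2_cover//] := boolP (j \in s2).
  by case/negP: ij_notin; apply/allpairsP; exists (i, j).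
- by rewrite allpairs_uniq ?undup_uniq // => -[? ?] [? ?].
rewrite big_allpairs (@coef_psum _ _ _ s1) ?undup_uniq //; last first.
  by move=> i i_s; apply: coef_psum0 => j; apply: s1_cover.
apply: eq_bigr => i _; rewrite (@coef_psum _ _ _ s2) ?undup_uniq // => j.
exact: s2_cover.
Qed.

Lemma summable_fst I J (f : I * J -> fps R) : summable f ->
  summable (fun i => psum (fun j => f (i, j))).
Proof.
move=> sum_f m; have [s s_cover] := sum_f m; exists (unzip1 s) => i i_s.
apply: coef_psum0 => j; apply: s_cover; apply: contra i_s.
exact: (map_f fst).
Qed.

Lemma summable_snd I J (f : I * J -> fps R) i : summable f ->
  summable (fun j => f (i, j)).
Proof.
move=> sum_f m; have [s s_cover] := sum_f m; exists (unzip2 s) => j j_s.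
by apply: s_cover; apply: contra j_s; apply: (map_f snd).
Qed.

End InfiniteSums.

(** * Order of vanishing and units *)

Section Order.
Variable R : comUnitRingType.
Implicit Types f g : fps R.

Definition fps_small (n : nat) f : Prop :=
  forall i, (i < n)%N -> fps_coef f i = 0.

Lemma fps_smallW m n f : (m <= n)%N -> fps_small n f -> fps_small m f.
Proof. by move=> le_mn f0 i lt_im; apply: f0; apply: leq_trans le_mn. Qed.

Lemma fps_smallD n f g : fps_small n f -> fps_small n g -> fps_small n (f + g).
Proof. by move=> f0 g0 i lt_in; rewrite fps_coefD f0 // g0 // addr0. Qed.

Lemma fps_smallN n f : fps_small n f -> fps_small n (- f).
Proof. by move=> f0 i lt_in; rewrite fps_coefN f0 // oppr0. Qed.

Lemma fps_smallM m n f g :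
  fps_small m f -> fps_small n g -> fps_small (m + n) (f * g).
Proof.
move=> f0 g0 i lt_i; rewrite fps_coefM big1 // => j _.
have [lt_jm | le_mj] := ltnP j m; first by rewrite f0 ?mul0r.
by rewrite g0 ?mulr0 //; move: (ltn_ord j); lia.
Qed.

Lemma fps_smallX m n f : fps_small m f -> fps_small (m * n) (f ^+ n).
Proof.
move=> f0; elim: n => [|n IHn]; first by rewrite muln0.
by rewrite exprS mulnS; apply: fps_smallM.
Qed.

Lemma fps_smallMr n f g : fps_small n f -> fps_small n (f * g).
Proof. by move=> f0; rewrite -[n]addn0; apply: fps_smallM. Qed.

Lemma fps_unitE f : (f \is a GRing.unit) = (fps_coef f 0 \is a GRing.unit).
Proof. by []. Qed.

Lemma fps_coef0M f g : fps_coef (f * g) 0 = fps_coef f 0 * fps_coef g 0.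
Proof. by rewrite fps_coefM big_ord1. Qed.

Lemma fps_coef0X f n : fps_coef (f ^+ n) 0 = fps_coef f 0 ^+ n.
Proof. by elim: n => // n IHn; rewrite !exprS fps_coef0M IHn. Qed.

Lemma fps_coef0_prod (I : Type) (r : seq I) (P : pred I) (F : I -> fps R) :
  fps_coef (\prod_(i <- r | P i) F i) 0 = \prod_(i <- r | P i) fps_coef (F i) 0.
Proof. by elim/big_rec2: _ => // i x y _ <-; rewrite fps_coef0M. Qed.

Lemma fps_unit1 f : fps_coef f 0 = 1 -> f \is a GRing.unit.
Proof. by rewrite fps_unitE => ->; apply: unitr1. Qed.

End Order.

(** * The Jacobi triple product *)

Section FiniteTripleProduct.
Variables (S : comUnitRingType) (A B : S).
Let Q := A * B.
Let Qp k := \prod_(i < k) (1 - Q ^+ i.+1).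
Hypothesis unit_Qp : forall k, Qp k \is a GRing.unit.

(** The Gaussian binomial coefficient that chooses k among k + j: with the sizes
    of the two parts as arguments, both Pascal rules take the same form. *)
Definition gauss k j := Qp (k + j) / (Qp k * Qp j).

Let QpS k : Qp k.+1 = Qp k * (1 - Q ^+ k.+1).
Proof. by rewrite /Qp big_ord_recr. Qed.

Let Qp0 : Qp 0 = 1. Proof. by rewrite /Qp big_ord0. Qed.

Lemma gauss0n j : gauss 0 j = 1.
Proof. by rewrite /gauss Qp0 mul1r divrr. Qed.

Lemma gaussn0 k : gauss k 0 = 1.
Proof. by rewrite /gauss Qp0 addn0 mulr1 divrr. Qed.

Let gaussE k j : gauss k j * (Qp k * Qp j) = Qp (k + j).
Proof. by rewrite /gauss divrK // unitrM !unit_Qp. Qed.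

Lemma gaussSl k j :
  gauss k.+1 j.+1 = gauss k.+1 j + Q ^+ j.+1 * gauss k j.+1.
Proof.
have unit_kj : Qp k.+1 * Qp j.+1 \is a GRing.unit by rewrite unitrM !unit_Qp.
apply: (mulIr unit_kj); rewrite gaussE mulrDl.
rewrite {1}(QpS j) {2}(QpS k).
transitivity (gauss k.+1 j * (Qp k.+1 * Qp j) * (1 - Q ^+ j.+1) +
  Q ^+ j.+1 * (1 - Q ^+ k.+1) * (gauss k j.+1 * (Qp k * Qp j.+1))); last by ring.
rewrite !gaussE !addnS !addSn (QpS (k + j).+1).
have -> : Q ^+ (k + j).+2 = Q ^+ k.+1 * Q ^+ j.+1 by rewrite -exprD addnS addSn.
ring.
Qed.

Lemma gaussSr k j :
  gauss k.+1 j.+1 = gauss k j.+1 + Q ^+ k.+1 * gauss k.+1 j.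
Proof.
have unit_kj : Qp k.+1 * Qp j.+1 \is a GRing.unit by rewrite unitrM !unit_Qp.
apply: (mulIr unit_kj); rewrite gaussE mulrDl.
rewrite {1}(QpS k) {2}(QpS j).
transitivity (gauss k j.+1 * (Qp k * Qp j.+1) * (1 - Q ^+ k.+1) +
  Q ^+ k.+1 * (1 - Q ^+ j.+1) * (gauss k.+1 j * (Qp k.+1 * Qp j))); last by ring.
rewrite !gaussE !addnS !addSn (QpS (k + j).+1).
have -> : Q ^+ (k + j).+2 = Q ^+ k.+1 * Q ^+ j.+1 by rewrite -exprD addnS addSn.
ring.
Qed.

(** The k-th term of the triple product series, shifted so that the constant
    term has index N. *)
Definition jtp_term N k : S :=
  if (N <= k)%N then (- A) ^+ (k - N) * Q ^+ 'C(k - N, 2)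
  else (- B) ^+ (N - k) * Q ^+ 'C(N - k, 2).

Let bin2S n : 'C(n.+1, 2) = (n + 'C(n, 2))%N.
Proof. by rewrite binS bin1 addnC. Qed.

Let jtp_termA N M k : (k <= N + M)%N ->
  jtp_term N k * - (A * Q ^+ M) = Q ^+ (N + M - k) * jtp_term N k.+1.
Proof.
move=> le_k; rewrite /jtp_term; have [le_Nk | lt_kN] := leqP N k.
  rewrite leqW // subSn // exprS bin2S exprD.
  have -> : M = (N + M - k + (k - N))%N by lia.
  have -> : (N + (N + M - k + (k - N)) - k = N + M - k)%N by lia.
  by rewrite exprD; ring.
have -> : (N + M - k = M + (N - k.+1).+1)%N by lia.
have [le_Nk1 | lt_k1N] := leqP N k.+1.
  have -> : (k.+1 - N = 0)%N by lia.
  have -> : (N - k = 1)%N by lia.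
  have -> : (N - k.+1 = 0)%N by lia.
  by rewrite addn1 (exprSr Q M) /Q !expr0 !expr1; ring.
have -> : (N - k = (N - k.+1).+1)%N by lia.
rewrite bin2S (exprS (- B)) !exprD (exprS Q).
by rewrite [Q * _](_ : _ = A * B * Q ^+ (N - k.+1)) //; ring.
Qed.

Let jtp_termB N k : jtp_term N k * - (B * Q ^+ N) = Q ^+ k * jtp_term N.+1 k.
Proof.
rewrite /jtp_term; have [lt_Nk | le_kN] := ltnP N k.
  rewrite ltnW //; have -> : (k - N = (k - N.+1).+1)%N by lia.
  have {3}-> : k = (N + (k - N.+1).+1)%N by lia.
  rewrite bin2S (exprS (- A)) !exprD (exprS Q).
  by rewrite [Q * _](_ : _ = A * B * Q ^+ (k - N.+1)) //; ring.
rewrite subSn // bin2S exprS exprD.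
have [le_Nk | lt_kN] := leqP N k.
  have -> : k = N by lia.
  by rewrite subnn; ring.
have -> : Q ^+ N = Q ^+ k * Q ^+ (N - k) by rewrite -exprD subnKC // ltnW.
ring.
Qed.

Definition jtp_sum N M := \sum_(k < (N + M).+1) gauss k (N + M - k) * jtp_term N k.

(** The factor 1 - A Q^M sends the term k to the term k + 1, with a power of Q
    that is the one of a Pascal rule. *)
Lemma jtp_sumA N M : jtp_sum N M * (1 - A * Q ^+ M) = jtp_sum N M.+1.
Proof.
rewrite /jtp_sum addnS mulrBr mulr1 -mulrN; set L := (N + M)%N.
rewrite big_distrl /=.
under [X in _ + X]eq_bigr => k _.
  rewrite -mulrA jtp_termA -?/L -1?ltnS // mulrCA; over.
rewrite big_ord_recl [X in _ + X]big_ord_recr [in RHS]big_ord_recl.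
rewrite [in RHS]big_ord_recr /= /bump /= !gauss0n add1n !subnn !gaussn0.
rewrite ?expr0 !mul1r -!addrA; congr (_ + _).
rewrite !addrA; congr (_ + _); rewrite -big_split /=; apply: eq_bigr => k _.
rewrite add1n subSS; have -> : (L - k = (L - k.+1).+1)%N by have := ltn_ord k; lia.
by rewrite gaussSl; ring.
Qed.

(** Likewise for 1 - B Q^N, which moves the origin of the indices, with the other
    Pascal rule. *)
Lemma jtp_sumB N M : jtp_sum N M * (1 - B * Q ^+ N) = jtp_sum N.+1 M.
Proof.
rewrite /jtp_sum addSn mulrBr mulr1 -mulrN; set L := (N + M)%N.
rewrite big_distrl /= addrC.
under eq_bigr => k _ do rewrite -mulrA jtp_termB mulrCA.
rewrite big_ord_recl [X in _ + X]big_ord_recr [in RHS]big_ord_recl.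
rewrite [in RHS]big_ord_recr /= /bump /= !gauss0n add1n !subnn !gaussn0.
rewrite ?expr0 !mul1r -!addrA; congr (_ + _).
have termS k : jtp_term N k = jtp_term N.+1 k.+1 by rewrite /jtp_term ltnS !subSS.
rewrite !addrA termS; congr (_ + _); rewrite -big_split /=; apply: eq_bigr => k _.
rewrite add1n subSS termS.
have -> : (L - k = (L - k.+1).+1)%N by have := ltn_ord k; lia.
by rewrite gaussSr; ring.
Qed.

(** In terms of A = x and B = Q/x, which only have to satisfy AB = Q, the finite
    triple product needs no negative powers and holds for x = q^a as well. *)
Lemma finite_triple_product N :
  (\prod_(i < N) (1 - A * Q ^+ i)) * (\prod_(i < N) (1 - B * Q ^+ i)) =
  jtp_sum N N.
Proof.
have jtpA M : jtp_sum 0 M = \prod_(i < M) (1 - A * Q ^+ i).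
  elim: M => [|M IHM]; last by rewrite -jtp_sumA IHM big_ord_recr.
  by rewrite big_ord0 /jtp_sum big_ord1 gauss0n /jtp_term leqnn subnn !expr0 !mulr1.
suff jtpB M : jtp_sum N M =
    (\prod_(i < M) (1 - A * Q ^+ i)) * (\prod_(i < N) (1 - B * Q ^+ i)) by [].
elim: N => [|N IHN]; first by rewrite big_ord0 mulr1.
by rewrite -jtp_sumB IHN [in RHS]big_ord_recr mulrA.
Qed.

End FiniteTripleProduct.

Section TripleProduct.
Variable R : comUnitRingType.

Definition zrange N : seq int := map Posz (iota 0 N.+1) ++ map Negz (iota 0 N).

Lemma mem_zrange N n : (n \in zrange N) = (`|n| <= N)%N.
Proof.
have notin (f g : nat -> int) s i : (forall j, f i != g j) -> f i \notin map g s.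
  by move=> fg; apply/mapP => -[j _ /eqP]; apply/negP/fg.
rewrite mem_cat; case: n => n.
  rewrite (@mem_map _ _ Posz) ?mem_iota => [|? ? []//].
  by rewrite (negPf (notin Posz Negz _ _ _)) ?orbF.
rewrite orbC (@mem_map _ _ Negz) ?mem_iota => [|? ? []//].
by rewrite (negPf (notin Negz Posz _ _ _)) ?orbF.
Qed.

Lemma zrange_uniq N : uniq (zrange N).
Proof.
rewrite cat_uniq !map_inj_uniq ?iota_uniq; try by move=> ? ? [].
by rewrite andbT; apply/hasPn => _ /mapP[i _ ->]; apply/mapP => -[].
Qed.

Variables (A B : fps R).
Let Q := A * B.
Hypothesis small_Q : fps_coef Q 0 = 0.

(** The terms of the sum of (-1)^n A^n Q^(n(n-1)/2), where A^-1 Q is read as B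
    for negative n. *)
Definition theta_term (n : int) : fps R :=
  match n with
  | Posz i => (- A) ^+ i * Q ^+ 'C(i, 2)
  | Negz i => (- B) ^+ i.+1 * Q ^+ 'C(i.+1, 2)
  end.

Let Qp k := \prod_(i < k) (1 - Q ^+ i.+1).

Let small_QX k : fps_small k (Q ^+ k).
Proof.
by rewrite -[X in fps_small X]mul1n; apply: fps_smallX => -[|//] _.
Qed.

Let Qp_coef0 k : fps_coef (Qp k) 0 = 1.
Proof.
rewrite fps_coef0_prod big1 // => i _.
by rewrite fps_coefD fps_coefN fps_coef0X small_Q expr0n /= oppr0 addr0.
Qed.

Let unit_Qp k : Qp k \is a GRing.unit.
Proof. exact: fps_unit1. Qed.

Let Qp_stable a b : (a <= b)%N -> fps_small a.+1 (Qp b - Qp a).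
Proof.
move=> /subnK <-; elim: (b - a)%N => [|c IHc]; first by rewrite subrr.
rewrite addSn /Qp big_ord_recr /= -/(Qp _) mulrBr mulr1 addrAC.
apply: fps_smallD => //; apply: fps_smallN; rewrite mulrC; apply: fps_smallMr.
by apply: (fps_smallW _ (@small_QX _)); lia.
Qed.

(** With (Q)_n the product of the first n factors 1 - Q^i, both (Q)_(a+c) / (Q)_c
    and (Q)_b / (Q)_a are 1 up to order a. *)
Let small_gauss a c b : (a <= c)%N -> (a <= b)%N ->
  fps_small a.+1 (gauss A B a c * Qp b - 1).
Proof.
move=> le_ac le_ab; rewrite /gauss -/Q -!/(Qp _).
have -> : Qp (a + c) / (Qp a * Qp c) * Qp b - 1 =
    (Qp (a + c) * Qp b - Qp a * Qp c) / (Qp a * Qp c).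
  by rewrite mulrBl divrr ?unitrM ?unit_Qp // mulrAC.
apply: fps_smallMr.
have -> : Qp (a + c) * Qp b - Qp a * Qp c =
  (Qp (a + c) - Qp c) * Qp b + (Qp b - Qp a) * Qp c by ring.
apply: fps_smallD; apply: fps_smallMr; last exact: Qp_stable.
by apply: (fps_smallW _ (@Qp_stable _ _ _)); rewrite ?leq_addl.
Qed.

Let gaussC a b : gauss A B a b = gauss A B b a.
Proof. by rewrite /gauss addnC (mulrC (\prod_(i < a) _)). Qed.

Lemma small_theta_term n : fps_small 'C(`|n|, 2) (theta_term n).
Proof.
by case: n => i; rewrite /= mulrC ?NegzE; apply: fps_smallMr; apply: small_QX.
Qed.

Let bin2_ge N : (0 < N)%N -> (N <= 'C(N.+1, 2))%N.
Proof. by case: N => // N _; rewrite binS bin1 leq_addl. Qed.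

Let theta_term0 N m n : (m < N)%N -> n \notin zrange N ->
  fps_coef (theta_term n) m = 0.
Proof.
rewrite mem_zrange -ltnNge => lt_mN lt_Nn; apply: small_theta_term.
have N_gt0 : (0 < N)%N by apply: leq_ltn_trans lt_mN.
apply: (leq_trans lt_mN); apply: (leq_trans (bin2_ge N_gt0)).
exact: leq_bin2l.
Qed.

Lemma summable_theta_term : summable theta_term.
Proof. by move=> m; exists (zrange m.+1) => n; apply: theta_term0. Qed.

(** The limit of the finite triple product: the coefficient of the term j differs
    from 1 at the order N - j + 1, and the power Q^C(j, 2) of this term lifts
    the difference beyond the order N. *)
Lemma coef_jacobi_triple_product N m : (m < N)%N ->
  fps_coef (psum theta_term) m =
  fps_coef ((\prod_(i < N) (1 - A * Q ^+ i)) * (\prod_(i < N) (1 - B * Q ^+ i))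
    * Qp N) m.
Proof.
move=> lt_mN; rewrite finite_triple_product //.
rewrite (@coef_psum _ _ _ _ (zrange N)) ?zrange_uniq //; last first.
  by move=> n; apply: theta_term0.
rewrite big_cat !big_map /jtp_sum mulr_suml fps_coef_sum.
have coef_term k : (k <= N + N)%N ->
    fps_coef (gauss A B k (N + N - k) * jtp_term A B N k * Qp N) m =
    fps_coef (jtp_term A B N k) m.
  move=> le_k; apply/eqP; rewrite -subr_eq0 -fps_coefN -fps_coefD; apply/eqP.
  have -> : gauss A B k (N + N - k) * jtp_term A B N k * Qp N -
      jtp_term A B N k =
      (gauss A B k (N + N - k) * Qp N - 1) * jtp_term A B N k by ring.
  suff: fps_small N ((gauss A B k (N + N - k) * Qp N - 1) * jtp_term A B N k).
    exact.
  have absorb j : (j <= N)%N -> (N <= (N - j).+1 + 'C(j, 2))%N.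
    case: j => [|j] lt_jN; first lia.
    by rewrite binS bin1; case: j lt_jN => [|j] ?; rewrite ?binS ?bin1; lia.
  rewrite /jtp_term; have [le_Nk | lt_kN] := leqP N k.
    apply: (fps_smallW (absorb (k - N)%N _)); first lia.
    apply: fps_smallM; last by rewrite mulrC; apply/fps_smallMr/small_QX.
    rewrite gaussC; have -> : (N - (k - N) = N + N - k)%N by lia.
    by apply: small_gauss; lia.
  apply: (fps_smallW (absorb (N - k)%N _)); first lia.
  apply: fps_smallM; last by rewrite mulrC; apply/fps_smallMr/small_QX.
  have -> : (N - (N - k) = k)%N by lia.
  by apply: small_gauss; lia.
transitivity (\sum_(k < (N + N).+1) fps_coef (jtp_term A B N k) m); last first.
  by apply: eq_bigr => k _; rewrite coef_term -1?ltnS.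
rewrite -(big_mkord xpredT (fun k => fps_coef (jtp_term A B N k) m)).
rewrite (@big_cat_nat _ _ _ N) //=; last by rewrite leqW // leq_addr.
rewrite addrC; congr (_ + _).
  rewrite big_nat_rev /index_iota subn0; apply: eq_big_seq => i.
  rewrite mem_iota /jtp_term => /= lt_iN; rewrite leqNgt.
  by have [-> ->] : (N - (0 + N - i.+1) = i.+1 /\ 0 + N - i.+1 < N)%N by lia.
have := big_addn 0 (N + N).+1 N xpredT (fun k => fps_coef (jtp_term A B N k) m).
rewrite add0n => ->; rewrite subSn ?leq_addr // addnK /index_iota subn0.
by apply: eq_bigr => i _; rewrite /jtp_term leq_addl addnK.
Qed.

End TripleProduct.

(** * Monomials *)

Section Monomials.
Variable R : comUnitRingType.
Implicit Types (c d : R) (e : int) (f g : fps R).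

(** The exponent is an integer, so that the quadratic exponents below can be
    compared by ring identities. *)
Definition mon c e : fps R := FPS (fun m => if e == m%:Z then c else 0).

Lemma coef_mon c e m : fps_coef (mon c e) m = if e == m%:Z then c else 0.
Proof. by []. Qed.

Lemma mon0 e : mon 0 e = 0.
Proof. by apply: fpsP => m; rewrite coef_mon if_same. Qed.

Lemma monN c e : mon (- c) e = - mon c e.
Proof.
by apply: fpsP => m; rewrite fps_coefN !coef_mon; case: ifP; rewrite ?oppr0.
Qed.

Lemma mon1 : mon 1 0 = 1.
Proof. by apply: fpsP => m; rewrite coef_mon fps_coef1 eqz_nat eq_sym; case: eqP. Qed.

Lemma monM c d (e e' : int) : 0 <= e -> 0 <= e' ->
  mon c e * mon d e' = mon (c * d) (e + e').
Proof.
case: e e' => // e [] // e' _ _; apply: fpsP => m.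
rewrite fps_coefM coef_mon -PoszD eqz_nat.
have [<-|neq_m] := eqVneq (e + e')%N m.
  have lt_e : (e < (e + e').+1)%N by rewrite ltnS leq_addr.
  rewrite (bigD1 (Ordinal lt_e)) //= big1 ?addr0 => [|j neq_j].
    by rewrite !coef_mon addKn !eqxx.
  rewrite coef_mon eqz_nat ifN ?mul0r //; apply: contra neq_j => /eqP e_j.
  exact/eqP/val_inj.
apply: big1 => j _; rewrite !coef_mon !eqz_nat.
have [e_j|] := eqVneq e j; last by rewrite mul0r.
have [e'_j|] := eqVneq e' (m - j)%N; last by rewrite mulr0.
by case/eqP: neq_m; rewrite e_j e'_j subnKC // -ltnS.
Qed.

Lemma monX c e n : 0 <= e -> mon c e ^+ n = mon (c ^+ n) (e * n%:Z).
Proof.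
move=> e_ge0; elim: n => [|n IHn]; first by rewrite mulr0 mon1.
by rewrite exprS IHn monM ?mulr_ge0 // exprS; congr mon; lia.
Qed.

Lemma const_qX c n : fps_const c * fps_q R ^+ n = mon c n%:Z.
Proof.
apply: fpsP => m; rewrite (coef_fps_constM c (fps_q R ^+ n)) coef_fps_qX.
by rewrite coef_mon eqz_nat (eq_sym n); case: eqP; rewrite ?mulr1 ?mulr0.
Qed.

Lemma mon_coef0 c e : 0 < e -> fps_coef (mon c e) 0 = 0.
Proof. by move=> e_gt0; rewrite coef_mon gt_eqF. Qed.

Lemma mon_factor (I : choiceType) c e0 (d : I -> R) (e : I -> int) :
  0 <= e0 -> (forall i, 0 <= e i) -> summable (fun i => mon (d i) (e i)) ->
  psum (fun i => mon (c * d i) (e0 + e i)) =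
  mon c e0 * psum (fun i => mon (d i) (e i)).
Proof.
by move=> ? ? ?; rewrite -psumMl //; apply: eq_psum => i; rewrite monM.
Qed.

End Monomials.

(** * Congruence of power series up to a given order *)

Section Congruence.
Variable R : comUnitRingType.
Implicit Types f g h : fps R.

(** Congruence modulo q^n is an equation between truncations, hence an
    equivalence relation for free. *)
Definition fps_trunc n f : fps R :=
  FPS (fun i => if (i < n)%N then fps_coef f i else 0).

Definition fps_eqm n f g : Prop := fps_trunc n f = fps_trunc n g.

Lemma fps_eqmI n f g :
  (forall i, (i < n)%N -> fps_coef f i = fps_coef g i) -> fps_eqm n f g.
Proof. by move=> fg; congr FPS; apply: funext => i; case: ifP => // /fg. Qed.

Lemma fps_eqm_coef n f g i :
  fps_eqm n f g -> (i < n)%N -> fps_coef f i = fps_coef g i.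
Proof.
move=> /(congr1 (fun h => fps_coef h i)) fg lt_in.
by move: fg; rewrite /fps_trunc /fps_coef lt_in.
Qed.

Lemma fps_eqm_sym n f g : fps_eqm n f g -> fps_eqm n g f.
Proof. exact: esym. Qed.

Lemma fps_eqm_trans n g f h : fps_eqm n f g -> fps_eqm n g h -> fps_eqm n f h.
Proof. exact: etrans. Qed.

Lemma fps_eqmW m n f g : (m <= n)%N -> fps_eqm n f g -> fps_eqm m f g.
Proof.
move=> le_mn fg; apply: fps_eqmI => i lt_im.
by apply: fps_eqm_coef fg _; apply: leq_trans le_mn.
Qed.

Lemma fps_eqmM n f f' g g' :
  fps_eqm n f f' -> fps_eqm n g g' -> fps_eqm n (f * g) (f' * g').
Proof.
move=> ff' gg'; apply: fps_eqmI => i lt_in; rewrite !fps_coefM.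
apply: eq_bigr => j _; congr (_ * _).
  by apply: fps_eqm_coef ff' _; apply: leq_ltn_trans lt_in; rewrite -ltnS.
by apply: fps_eqm_coef gg' _; apply: leq_ltn_trans (leq_subr _ _) lt_in.
Qed.

Lemma fps_eqm_prod (I : Type) (r : seq I) (F G : I -> fps R) n :
  (forall i, fps_eqm n (F i) (G i)) ->
  fps_eqm n (\prod_(i <- r) F i) (\prod_(i <- r) G i).
Proof. by move=> FG; elim/big_rec2: _ => // i y x _; apply: fps_eqmM. Qed.

Lemma fps_eqmP f g : (forall n, fps_eqm n f g) -> f = g.
Proof. by move=> fg; apply: fpsP => m; apply: fps_eqm_coef (fg m.+1) _. Qed.

Definition one_upto (F : nat -> fps R) : Prop :=
  forall n i, (i < n)%N -> fps_coef (F n) i = (i == 0)%N%:R.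

Lemma infprod_eqm (F : nat -> fps R) N : one_upto F ->
  fps_eqm N.+1 (fps_infprod F) (\prod_(i < N) F i.+1).
Proof.
move=> F1; apply: fps_eqmI => i lt_iN.
by rewrite (@coef_fps_infprod _ F i N) // big_add1 big_mkord.
Qed.

Lemma infprodM (F G : nat -> fps R) : one_upto F -> one_upto G ->
  fps_infprod F * fps_infprod G = fps_infprod (fun n => F n * G n).
Proof.
move=> F1 G1; apply: fps_eqmP => N; apply: (@fps_eqmW _ N.+1) => //.
apply: fps_eqm_trans (fps_eqmM (infprod_eqm N F1) (infprod_eqm N G1)) _.
rewrite -big_split /=; apply/fps_eqm_sym/infprod_eqm => n i lt_in.
exact: (coef_fps_mul_small (F1 n) (G1 n)).
Qed.

Lemma eq_infprod (F G : nat -> fps R) :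
  (forall n, (0 < n)%N -> F n = G n) -> fps_infprod F = fps_infprod G.
Proof.
move=> FG; apply: fpsP => m; rewrite /fps_infprod /fps_coef.
by congr (fps_coef _ _); apply: eq_big_nat => n /andP[/FG].
Qed.

End Congruence.

(** * Infinite products in arithmetic progression *)

Section Products.
Variable R : comUnitRingType.

Definition qprod (x : R) (a b : nat) : fps R :=
  fps_infprod (fun n => 1 - mon x (a + b * n.-1)%N%:Z).

Let qprod_factor x a b : (0 < a)%N -> (0 < b)%N ->
  @one_upto R (fun n => 1 - mon x (a + b * n.-1)%N%:Z).
Proof.
move=> a_gt0 b_gt0 n i lt_in; rewrite fps_coefD fps_coefN fps_coef1 coef_mon.
by rewrite eqz_nat ifN ?subr0 //; nia.
Qed.

Lemma qprod_eqm x a b N : (0 < a)%N -> (0 < b)%N ->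
  fps_eqm N.+1 (qprod x a b) (\prod_(i < N) (1 - mon x (a + b * i)%N%:Z)).
Proof. by move=> a_gt0 b_gt0; apply: infprod_eqm; apply: qprod_factor. Qed.

Lemma qprod_coef0 x a b : (0 < a)%N -> (0 < b)%N -> fps_coef (qprod x a b) 0 = 1.
Proof. by move=> a0 b0; rewrite (fps_eqm_coef (qprod_eqm x 0 a0 b0)) // big_ord0. Qed.

Lemma qprod_unit x a b : (0 < a)%N -> (0 < b)%N -> qprod x a b \is a GRing.unit.
Proof. by move=> a0 b0; apply/fps_unit1/qprod_coef0. Qed.

Let prod_ord_mul (F : nat -> fps R) N d :
  \prod_(i < N * d) F i = \prod_(j < d) \prod_(i < N) F (j + d * i)%N.
Proof.
elim: N => [|N IHN]; first by rewrite big_ord0 big1 // => j _; rewrite big_ord0.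
rewrite mulSnr big_split_ord /= IHN -big_split /=; apply: eq_bigr => j _.
by rewrite big_ord_recr /= addnC [(N * d)%N]mulnC.
Qed.

(** The factors are sorted according to their index modulo d. *)
Lemma qprod_decimate x a b d : (0 < a)%N -> (0 < b)%N -> (0 < d)%N ->
  qprod x a b = \prod_(j < d) qprod x (a + b * j) (b * d).
Proof.
move=> a0 b0 d0; apply: fps_eqmP => N.
apply: (@fps_eqm_trans _ _ (\prod_(i < N * d) (1 - mon x (a + b * i)%N%:Z))).
  by apply: fps_eqmW (qprod_eqm x _ a0 b0); rewrite leqW // leq_pmulr.
rewrite (prod_ord_mul (fun i => 1 - mon x (a + b * i)%N%:Z)).
apply: fps_eqm_prod => j.
have a'0 : (0 < a + b * j)%N by rewrite addn_gt0 a0.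
have b'0 : (0 < b * d)%N by rewrite muln_gt0 b0.
apply: fps_eqm_sym; apply: (@fps_eqmW _ _ N.+1) => //.
apply: fps_eqm_trans (qprod_eqm x N a'0 b'0) _; congr fps_trunc.
by apply: eq_bigr => k _; rewrite mulnDr mulnA addnA.
Qed.

End Products.

(** * Theta series *)

Definition tri (n : int) : int := (n * (n - 1) %/ 2)%Z.

Lemma tri2 n : 2 * tri n = n * (n - 1).
Proof.
have [a [b [-> b01]]] : exists a b : int, n = 2 * a + b /\ (b = 0 \/ b = 1).
  by exists (n %/ 2)%Z, (n %% 2)%Z; lia.
case: b01 => ->; rewrite /tri.
  have -> : (2 * a + 0) * (2 * a + 0 - 1) = a * (2 * a - 1) * 2 by ring.
  by rewrite mulzK // mulrC.
have -> : (2 * a + 1) * (2 * a + 1 - 1) = a * (2 * a + 1) * 2 by ring.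
by rewrite mulzK // mulrC.
Qed.

Lemma tri_ge0 n : 0 <= tri n.
Proof. by have := tri2 n; nia. Qed.

Lemma tri_bin (i : nat) : tri i%:Z = 'C(i, 2)%:Z.
Proof.
suff: 2 * tri i%:Z = 2 * 'C(i, 2)%:Z by lia.
rewrite tri2; elim: i => // i IHi; rewrite binS bin1; lia.
Qed.

Lemma tri_bin_neg (i : nat) : tri (- i%:Z) = 'C(i.+1, 2)%:Z.
Proof.
suff: 2 * tri (- i%:Z) = 2 * 'C(i.+1, 2)%:Z by lia.
by rewrite -tri_bin !tri2; lia.
Qed.

Section Theta.
Variable K : fieldType.
Implicit Types x : K.

(** The theta series in base q^b at the point x q^a; a power of q in the argument
    is kept apart from x, which is a scalar. *)
Definition theta_mon x (a b : nat) (n : int) : fps K :=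
  mon ((-1) ^ n * x ^ n) (b%:Z * tri n + a%:Z * n).

Definition theta x a b : fps K := psum (theta_mon x a b).

Let A x (a : nat) : fps K := mon x a%:Z.
Let B x (a b : nat) : fps K := mon x^-1 (b - a)%N%:Z.

Let AB x a b : x != 0 -> (a <= b)%N -> A x a * B x a b = mon 1 b%:Z.
Proof. by move=> x0 le_ab; rewrite /A /B monM // divff // -PoszD subnKC. Qed.

Let theta_monE x a b n : x != 0 -> (a <= b)%N ->
  theta_mon x a b n = theta_term (A x a) (B x a b) n.
Proof.
move=> x0 le_ab; rewrite /theta_mon.
rewrite -exprMz_comm ?unitfE ?oppr_eq0 ?oner_eq0 //; last exact: mulrC.
rewrite mulN1r; case: n => i; rewrite /theta_term AB // /A /B -monN !monX //.
  by rewrite monM // expr1n mulr1 tri_bin; congr mon; lia.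
rewrite monM ?mulr_ge0 // expr1n mulr1.
rewrite NegzE tri_bin_neg -exprnN -(invrN x) exprVn; congr mon.
rewrite (binS i.+1 1) bin1; nia.
Qed.

Lemma theta_mon_exp_ge0 (a b : nat) n : (a <= b)%N -> 0 <= b%:Z * tri n + a%:Z * n.
Proof.
move=> le_ab; case: n => i; first by rewrite addr_ge0 // mulr_ge0 // tri_ge0.
rewrite NegzE tri_bin_neg (binS i.+1 1) bin1; nia.
Qed.

Lemma summable_theta x a b : x != 0 -> (a <= b)%N -> (0 < b)%N ->
  summable (theta_mon x a b).
Proof.
move=> x0 le_ab b0; rewrite (_ : theta_mon x a b = theta_term (A x a) (B x a b)).
  by apply: summable_theta_term; rewrite AB // mon_coef0.
by apply: funext => n; apply: theta_monE.
Qed.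

Let theta_eqm x a b N : x != 0 -> (a <= b)%N -> (0 < b)%N ->
  fps_eqm N (theta x a b)
   ((\prod_(i < N) (1 - mon x (a + b * i)%N%:Z)) *
    (\prod_(i < N) (1 - mon x^-1 ((b - a) + b * i)%N%:Z)) *
    (\prod_(i < N) (1 - mon 1 (b + b * i)%N%:Z))).
Proof.
move=> x0 le_ab b0; apply: fps_eqmI => m lt_mN; rewrite /theta.
rewrite (eq_psum (fun n => theta_monE n x0 le_ab)).
rewrite (coef_jacobi_triple_product _ lt_mN) ?AB ?mon_coef0 //.
congr (fps_coef (_ * _ * _) _); apply: eq_bigr => i _;
  rewrite monX // ?monM // expr1n ?mulr1 // ?PoszD ?PoszM //.
by congr (_ - mon _ _); lia.
Qed.

Lemma jacobi_triple_product x a b : x != 0 -> (0 < a < b)%N ->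
  theta x a b = qprod x a b * qprod x^-1 (b - a) b * qprod 1 b b.
Proof.
move=> x0 /andP[a0 lt_ab]; have b0 : (0 < b)%N by apply: leq_trans lt_ab.
apply: fps_eqmP => N; apply: fps_eqm_trans (theta_eqm N x0 (ltnW lt_ab) b0) _.
apply: fps_eqm_sym; apply: fps_eqmM; first apply: fps_eqmM.
- by apply: (@fps_eqmW _ _ N.+1) => //; apply: qprod_eqm.
- by apply: (@fps_eqmW _ _ N.+1) => //; apply: qprod_eqm; rewrite ?subn_gt0.
- by apply: (@fps_eqmW _ _ N.+1) => //; apply: qprod_eqm.
Qed.

(** For a = 0 the first product has the constant factor 1 - x. *)
Lemma jacobi_triple_product0 x : x != 0 ->
  theta x 0 1 = mon (1 - x) 0 * (qprod x 1 1 * qprod x^-1 1 1 * qprod 1 1 1).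
Proof.
move=> x0; apply: fps_eqmP => N; apply: (@fps_eqmW _ _ N.+1) => //.
apply: fps_eqm_trans (theta_eqm N.+1 x0 _ _) _ => //.
have -> : mon (1 - x) 0 = 1 - mon x 0%N%:Z.
  apply: fpsP => i; rewrite fps_coefD fps_coefN fps_coef1 !coef_mon eqz_nat.
  by rewrite eq_sym; case: eqP; rewrite ?subrr.
rewrite big_ord_recl -!mulrA muln0.
apply: fps_eqmM => //; apply: fps_eqm_sym; apply: fps_eqmM.
  exact: qprod_eqm.
by apply: fps_eqmM; apply: (@fps_eqmW _ _ N.+2) => //; apply: qprod_eqm.
Qed.

(** Euler's pentagonal number theorem in base q^c: the three products of the
    theta series in base q^(3c) at q^c are the three classes of factors modulo
    3. *)
Lemma euler_pentagonal c : (0 < c)%N -> theta 1 c (c * 3) = qprod 1 c c.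
Proof.
move=> c0; rewrite jacobi_triple_product ?oner_eq0 //; last by lia.
rewrite (@qprod_decimate _ 1 c c 3) // !big_ord_recl big_ord0 mulr1 invr1 /=.
rewrite /bump /= !muln0 !addn0 muln1 mulrA; congr (_ * _ * _).
  by congr (qprod _ _ _); lia.
by congr (qprod _ _ _); lia.
Qed.

(** By the triple product, the left-hand side runs twice through the exponents in
    each non-zero class modulo 4 and three times through the multiples of 4. *)
Lemma theta4_prod :
  theta 1 1 4 * theta 1 1 4 * theta 1 2 4 = qprod 1 4 4 * qprod (1 : K) 1 1 ^+ 2.
Proof.
rewrite !jacobi_triple_product ?oner_eq0 // invr1.
rewrite (@qprod_decimate _ 1 1 1 4) // !big_ord_recl big_ord0 /=; ring.
Qed.

Lemma theta4_sym : theta 1 3 4 = theta (1 : K) 1 4.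
Proof.
rewrite !jacobi_triple_product ?oner_eq0 // invr1.
by rewrite [in LHS](mulrC (qprod _ _ _)).
Qed.

End Theta.

(** * Signs and shifted pentagonal sums *)

Section Signs.
Variable K : numFieldType.

Definition sgn (n : int) : K := (-1) ^ n.

Lemma sgnD m n : sgn (m + n) = sgn m * sgn n.
Proof. by rewrite /sgn expfzDr // oppr_eq0 oner_eq0. Qed.

Lemma sgn_double n : sgn (n + n) = 1.
Proof. by rewrite sgnD /sgn -exprMz_comm ?mulrNN ?mulr1 ?exp1rz // unitrN1. Qed.

Lemma sgn_neq0 n : sgn n != 0.
Proof. by rewrite expfz_neq0 // oppr_eq0 oner_eq0. Qed.

Lemma sgn_eq m n : (2 %| m - n)%Z -> sgn m = sgn n.
Proof.
case/dvdzP => d def_mn; have -> : m = n + (d + d) by lia.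
by rewrite sgnD sgn_double mulr1.
Qed.

Lemma sgn1 : sgn 1 = -1. Proof. by []. Qed.

(** An involution of the indices that changes the sign of all the terms of
    degree m makes them cancel in pairs. *)
Lemma coef_psum_antisym (I : choiceType) (h : I -> I) (f : I -> fps K) m :
  bijective h -> summable f ->
  (forall i, fps_coef (f (h i)) m = - fps_coef (f i) m) ->
  fps_coef (psum f) m = 0.
Proof.
move=> bij_h sum_f f_anti; have [s [uniq_s s_cover]] := summable_uniq m sum_f.
have : fps_coef (psum f) m = - fps_coef (psum f) m.
  rewrite {1}(psum_reindex f bij_h) !(@coef_psum _ _ _ m s) //; last first.
    by move=> i /s_cover fi0; rewrite /= f_anti fi0 oppr0.
  by rewrite -sumrN; apply: eq_bigr => i _ /=.
by move/eqP; rewrite -addr_eq0 -mulr2n mulrn_eq0 => /eqP.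
Qed.

Lemma tri_add a b : tri (a + b) = tri a + tri b + a * b.
Proof. by have := tri2 (a + b); have := tri2 a; have := tri2 b; lia. Qed.

Lemma tri_opp a : tri (- a) = tri a + a.
Proof. by have := tri2 (- a); have := tri2 a; lia. Qed.

Lemma shift_bij (c : int) : bijective (fun n => n + c).
Proof. by exists (fun n => n - c) => n; rewrite ?addrK ?subrK. Qed.

Lemma opp_bij : bijective (fun n : int => - n).
Proof. by exists (fun n : int => - n) => n; rewrite opprK. Qed.

Lemma theta_at0 b : (0 < b)%N -> theta (1 : K) 0 b = 0.
Proof.
move=> b0; apply: fpsP => m.
apply: (@coef_psum_antisym int (fun n : int => - n + 1)).
- by exists (fun n => - n + 1) => n; rewrite opprD opprK subrK.
- by apply: summable_theta; rewrite ?oner_eq0.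
move=> n; rewrite -fps_coefN; congr (fps_coef _ m).
rewrite /theta_mon -monN !exp1rz !mulr1 -/(sgn _) -/(sgn _).
congr mon; last by rewrite tri_add tri_opp (_ : tri 1 = 0) //; lia.
by rewrite sgnD sgn1 mulrN1; congr (- _); apply: sgn_eq; lia.
Qed.

(** The Legendre symbol of s + 1 modulo 3. *)
Definition psi (s : int) : K :=
  if (s %% 3)%Z == 0 then 1 else if (s %% 3)%Z == 1 then -1 else 0.

(** Minus the exponent 3k(k-1)/2 + (2-s)k at k = s %/ 3, the index to which the
    shifted pentagonal sum is recentred. *)
Definition pentw (s : int) : int :=
  let r := (s %/ 3)%Z in - (3 * tri r + (2 - s) * r).

(** Completing the square, pentw s is s(s-1)/6 on the classes of s where the sum
    does not vanish. *)
Lemma pentw6 s :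
  6 * pentw s = s * (s - 1) - (if (s %% 3)%Z == 2 then 2 else 0).
Proof.
rewrite /pentw; have := tri2 (s %/ 3)%Z.
have [s_r s0_ge0 s0_lt3] : [/\ s = 3 * (s %/ 3)%Z + (s %% 3)%Z,
  0 <= (s %% 3)%Z & (s %% 3)%Z < 3] by split; lia.
move: (s %/ 3)%Z (s %% 3)%Z s_r s0_ge0 s0_lt3 => r s0 -> s0_ge0 s0_lt3.
have : s0 = 0 \/ s0 = 1 \/ s0 = 2 by lia.
by case=> [|[]] -> /=; lia.
Qed.

(** The shift of the index by s %/ 3 turns the sum into the pentagonal one when
    s is 0 or 1 modulo 3; when s is 2 modulo 3 the exponent becomes 3k(k-1)/2
    and the terms k and 1 - k cancel. *)
Lemma pent_shift c s e0 (d : K) :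
  (0 < c)%N -> 0 <= e0 - c%:Z * pentw s ->
  psum (fun k => mon (d * sgn (s + k)) (e0 + c%:Z * (3 * tri k + (2 - s) * k))) =
  mon (d * psi s) (e0 - c%:Z * pentw s) * qprod 1 c c.
Proof.
move=> c0 C_ge0; set r := (s %/ 3)%Z; set s0 := (s %% 3)%Z.
rewrite (psum_reindex _ (shift_bij r)).
have -> : (fun k => mon (d * sgn (s + k)) (e0 + c%:Z * (3 * tri k + (2 - s) * k)))
    \o (fun n => n + r) = fun i => mon (d * sgn s0 * sgn i)
    ((e0 - c%:Z * pentw s) + c%:Z * (3 * tri i + (2 - s0) * i)).
  apply: funext => i /=; congr mon.
    by rewrite -mulrA -sgnD; congr (_ * _); apply: sgn_eq; rewrite /r /s0; lia.
  rewrite /pentw -/r tri_add; have -> : s0 = s - 3 * r by rewrite /s0 /r; lia.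
  ring.
have sum3 a : (a <= 3)%N -> summable (fun i =>
    mon (sgn i) (c%:Z * (3 * tri i + a%:Z * i))) /\
    psum (fun i => mon (sgn i) (c%:Z * (3 * tri i + a%:Z * i))) =
    theta (1 : K) (c * a) (c * 3).
  move=> le_a3.
  have -> : (fun i => mon (sgn i) (c%:Z * (3 * tri i + a%:Z * i))) =
      theta_mon (1 : K) (c * a) (c * 3).
    by apply: funext => i; rewrite /theta_mon exp1rz mulr1; congr mon; lia.
  by split=> //; apply: summable_theta; rewrite ?oner_eq0 ?leq_pmul2l ?muln_gt0 ?c0.
have exp_ge0 a i : (a <= 3)%N -> 0 <= c%:Z * (3 * tri i + a%:Z * i).
  by move=> le_a3; apply: mulr_ge0 => //; apply: (@theta_mon_exp_ge0 a 3).
have s0_cases : s0 = 0 \/ s0 = 1 \/ s0 = 2 by rewrite /s0; lia.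
case: s0_cases => [s0E|[s0E|s0E]].
- have [sum2 E2] := sum3 2%N isT; rewrite s0E.
  rewrite (mon_factor _ C_ge0 (fun i => exp_ge0 2%N i isT) sum2) E2.
  rewrite /psi -/s0 s0E /=; congr (_ * _).
  rewrite -euler_pentagonal //.
  rewrite /theta (psum_reindex _ opp_bij); apply: eq_psum => i /=.
  rewrite /theta_mon !exp1rz !mulr1 tri_opp; congr mon; last by lia.
  by apply: sgn_eq; lia.
- have [sum1 E1] := sum3 1%N isT; rewrite s0E.
  rewrite (mon_factor _ C_ge0 (fun i => exp_ge0 1%N i isT) sum1) E1.
  by rewrite /psi -/s0 s0E /= muln1 euler_pentagonal.
have [sum0 E0] := sum3 0%N isT; rewrite s0E.
rewrite (mon_factor _ C_ge0 (fun i => exp_ge0 0%N i isT) sum0) E0 muln0 theta_at0.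
  by rewrite /psi -/s0 s0E /= !mulr0 mon0 mul0r.
by rewrite muln_gt0 c0.
Qed.

End Signs.

(** * Macdonald identities of rank two *)

Section Macdonald.
Variable K : numFieldType.
Implicit Types x y : K.
Local Notation sgn := (sgn K).
Local Notation psi := (psi K).
Local Notation E := (qprod (1 : K) 1 1).

Lemma theta_mon01 x n : theta_mon x 0 1 n = mon (sgn n * x ^ n) (tri n).
Proof. by rewrite /theta_mon; congr mon; lia. Qed.

Lemma summable_theta01 x : x != 0 -> summable (theta_mon x 0 1).
Proof. by move=> x0; apply: summable_theta. Qed.

Lemma qprod1_unit c : (0 < c)%N -> qprod (1 : K) c c \is a GRing.unit.
Proof. by move=> c0; apply: qprod_unit. Qed.

Lemma summable_cancel (I : choiceType) (f : I -> fps K) g :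
  g \is a GRing.unit -> summable (fun i => f i * g) -> summable f.
Proof.
move=> unit_g /(@summableMr _ _ _ g^-1).
by under eq_fun do rewrite mulrK //.
Qed.

(** With M = m - 1 and N = n - 1, this is (M^2 - M N + N^2 - 1) / 3 unless
    m + n is 2 modulo 3, where the coefficient psi (m + n) vanishes. *)
Definition a2_exp (m n : int) : int := tri m + tri n - pentw (m + n).

Lemma a2_exp_ge0 m n : 0 <= a2_exp m n.
Proof.
have := sqr_ge0 (2 * m - n - 1); have := sqr_ge0 (n - 1); rewrite !expr2 /a2_exp.
have := tri2 m; have := tri2 n; have := pentw6 (m + n).
by case: ifP => _; lia.
Qed.

Definition a2_mon x y (p : int * int) : fps K :=
  mon (x ^ p.1 * y ^ p.2 * psi (p.1 + p.2)) (a2_exp p.1 p.2).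

Lemma expz_sub x m k : x != 0 -> x ^ (m - k) * x ^ k = x ^ m.
Proof. by move=> x0; rewrite -expfzDr // subrK. Qed.

(** In the product of the three series, the terms whose monomial is x^m y^n have
    indices m - k, n - k and k. Their exponent is quadratic in k with leading
    term 3k^2/2, so that they form a shifted pentagonal sum, which is a multiple
    of Euler's product E that depends only on m + n. *)
Lemma macdonald_A2_family x y : x != 0 -> y != 0 ->
  summable (fun p => a2_mon x y p * E) /\
  theta x 0 1 * theta y 0 1 * theta (x * y) 0 1 =
    psum (fun p => a2_mon x y p * E).
Proof.
move=> x0 y0; have xy0 : x * y != 0 by rewrite mulf_neq0.
have sum_xy := summableM (summable_theta01 x0) (summable_theta01 y0).
have sum_xyz := summableM sum_xy (summable_theta01 xy0).
rewrite /theta psumM ?psumM //; try exact: summable_theta01.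
pose h (p : int * int * int) := (p.1.1 - p.2, p.1.2 - p.2, p.2).
have bij_h : bijective h.
  by exists (fun p => (p.1.1 + p.2, p.1.2 + p.2, p.2)) => -[[m n] k];
     rewrite /h /= ?addrK ?subrK.
have sum_h := summable_reindex bij_h sum_xyz.
rewrite (psum_reindex _ bij_h) (psum_pair sum_h).
have inner p : psum (fun k => ((fun q : int * int * int => theta_mon x 0 1 q.1.1 *
    theta_mon y 0 1 q.1.2 * theta_mon (x * y) 0 1 q.2) \o h) (p, k)) =
    a2_mon x y p * E.
  case: p => m n /=.
  have -> : a2_mon x y (m, n) = mon (x ^ m * y ^ n * psi (m + n))
      (tri m + tri n - 1%:Z * pentw (m + n)) by rewrite /a2_mon mul1r.
  rewrite -pent_shift // ?mul1r; last exact: a2_exp_ge0.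
  apply: eq_psum => k; rewrite !theta_mon01 !monM ?addr_ge0 ?tri_ge0 //.
  congr mon.
    rewrite expfzMl -(expz_sub m k x0) -(expz_sub n k y0).
    rewrite (_ : sgn (m + n + k) = sgn (m - k) * sgn (n - k) * sgn k); first ring.
    by rewrite -!sgnD; apply: sgn_eq; lia.
  by rewrite !tri_add tri_opp; have := tri2 k; lia.
by split; [rewrite -(funext inner); apply: summable_fst | apply: eq_psum].
Qed.

Lemma summable_a2 x y : x != 0 -> y != 0 -> summable (a2_mon x y).
Proof.
move=> x0 y0; have [sum_E _] := macdonald_A2_family x0 y0.
exact: summable_cancel (qprod1_unit _) sum_E.
Qed.

Lemma macdonald_A2 x y : x != 0 -> y != 0 ->
  theta x 0 1 * theta y 0 1 * theta (x * y) 0 1 = psum (a2_mon x y) * E.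
Proof.
move=> x0 y0; have [_ ->] := macdonald_A2_family x0 y0.
exact/psumMr/summable_a2.
Qed.

(** With M = 2m - 3 and N = 2n - 1, this is (M^2 + N^2 - 10) / 24 where the
    coefficient does not vanish. *)
Definition b2_exp (m n : int) : int :=
  tri m + tri n - pentw (m + n) - pentw (m - n + 1).

Definition b2_mon x y (p : int * int) : fps K :=
  mon (x ^ p.1 * y ^ p.2 * psi (p.1 + p.2) *
    (sgn (p.1 - p.2 + 1) * psi (p.1 - p.2 + 1))) (b2_exp p.1 p.2).

Lemma pentw_ge s k : 0 <= 3 * tri k + (2 - s) * k + pentw s.
Proof.
have := pentw6 s; have := tri2 k.
(* Six times the claim is u (u + 1) >= 0, or (u - 1) (u + 2) >= 0, at u = 3k - s *)
case: ifP => [/eqP s2|_].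
  have : 0 <= (3 * k - s - 1) * (3 * k - s + 2).
    have [|] : 3 * k - s >= 1 \/ 3 * k - s <= - 2 by lia.
      by move=> ?; nia.
    by move=> ?; nia.
  lia.
have : 0 <= (3 * k - s) * (3 * k - s + 1).
  have [|] : 3 * k - s >= 0 \/ 3 * k - s <= - 1 by lia.
    by move=> ?; nia.
  by move=> ?; nia.
lia.
Qed.

(** The terms with monomial x^m y^n have indices m - k - l, n - k + l, k and l.
    The mixed terms in k l cancel in the exponent, and the sum over k and l is
    the product of two shifted pentagonal sums. *)
Lemma macdonald_B2_family x y : x != 0 -> y != 0 ->
  summable (fun p => b2_mon x y p * (E * E)) /\
  theta x 0 1 * theta y 0 1 * (theta (x * y) 0 1 * theta (x / y) 0 1) =
    psum (fun p => b2_mon x y p * (E * E)).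
Proof.
move=> x0 y0; have xy0 : x * y != 0 by rewrite mulf_neq0.
have xVy0 : x / y != 0 by rewrite mulf_neq0 ?invr_neq0.
have sum1 := summableM (summable_theta01 x0) (summable_theta01 y0).
have sum2 := summableM (summable_theta01 xy0) (summable_theta01 xVy0).
have sum12 := summableM sum1 sum2.
rewrite /theta !psumM //; try exact: summable_theta01.
pose h (p : int * int * (int * int)) :=
  (p.1.1 - p.2.1 - p.2.2, p.1.2 - p.2.1 + p.2.2, p.2).
have bij_h : bijective h.
  exists (fun p => (p.1.1 + p.2.1 + p.2.2, p.1.2 + p.2.1 - p.2.2, p.2)) =>
    -[[m n] [k l]]; rewrite /h /=; congr (_, _, _); lia.
have sum_h := summable_reindex bij_h sum12.
rewrite (psum_reindex _ bij_h) (psum_pair sum_h).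
have inner p : psum (fun k => ((fun q : int * int * (int * int) =>
    theta_mon x 0 1 q.1.1 * theta_mon y 0 1 q.1.2 *
    (theta_mon (x * y) 0 1 q.2.1 * theta_mon (x / y) 0 1 q.2.2)) \o h) (p, k)) =
    b2_mon x y p * (E * E).
  have sum_p := summable_snd p sum_h.
  rewrite (psum_pair sum_p); case: p sum_p => m n sum_p.
  have C_ge0 : 0 <= b2_exp m n.
    have := sqr_ge0 (2 * m - 3); have := sqr_ge0 (2 * n - 1); rewrite !expr2.
    rewrite /b2_exp; have := tri2 m; have := tri2 n; have := pentw6 (m + n).
    by have := pentw6 (m - n + 1); do 2!case: ifP => _; lia.
  set s := m + n; set s' := m - n + 1; rewrite /b2_exp -/s -/s' in C_ge0.
  pose d := x ^ m * y ^ n * sgn s' * psi s'.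
  pose e0 := tri m + tri n - pentw s'.
  pose F k := mon (d * sgn (s + k)) (e0 + 1%:Z * (3 * tri k + (2 - s) * k)).
  have innerl k : psum (fun l => ((fun q : int * int * (int * int) =>
      theta_mon x 0 1 q.1.1 * theta_mon y 0 1 q.1.2 *
      (theta_mon (x * y) 0 1 q.2.1 * theta_mon (x / y) 0 1 q.2.2)) \o h)
      ((m, n), (k, l))) = F k * E.
    pose c := x ^ m * y ^ n * sgn s' * sgn (s + k).
    pose e := tri m + tri n + (3 * tri k + (2 - s) * k).
    have -> : F k = mon (c * psi s') (e - 1%:Z * pentw s').
      by congr mon; rewrite /d /c /e /e0; [ring | lia].
    rewrite -pent_shift //; last first.
      by have := pentw_ge s k; rewrite /e; lia.
    apply: eq_psum => l; rewrite /h /= !theta_mon01 !monM ?addr_ge0 ?tri_ge0 //.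
    congr mon; last first.
      rewrite /e /s /s' !tri_add !tri_opp; have := tri2 k; have := tri2 l; lia.
    rewrite /c -[m - k - l]addrA -[n - k + l]addrA expfzMl [(x / y) ^ l]expfzMl.
    have -> : x ^ (m + (- k - l)) = x ^ m / (x ^ k * x ^ l).
      by rewrite -opprD !expfzDr // -invr_expz expfzDr.
    have -> : y ^ (n + (- k + l)) = y ^ n * y ^ l / y ^ k.
      by rewrite !expfzDr // -invr_expz; ring.
    rewrite exprz_inv -invr_expz.
    rewrite (_ : _ * sgn (s' + l) = x ^ m * y ^ n * (sgn (m + (- k - l)) *
      sgn (n + (- k + l)) * (sgn k * sgn l))).
      by field; rewrite !expfz_neq0.
    rewrite -!mulrA -!sgnD; congr (_ * (_ * _)); apply: sgn_eq; rewrite /s /s'; lia.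
  rewrite (eq_psum innerl) psumMr; last first.
    apply: (summable_cancel (qprod1_unit (ltn0Sn 0))).
    by rewrite -(funext innerl); apply: summable_fst sum_p.
  rewrite mulrA; congr (_ * _); rewrite /F pent_shift //; last by rewrite /e0; lia.
  rewrite /b2_mon /= -/s -/s'; congr (mon _ _ * _); first by rewrite /d; ring.
  by rewrite /e0 /b2_exp -/s -/s'; lia.
by split; [rewrite -(funext inner); apply: summable_fst | apply: eq_psum].
Qed.

Lemma summable_b2 x y : x != 0 -> y != 0 -> summable (b2_mon x y).
Proof.
move=> x0 y0; have [sum_E _] := macdonald_B2_family x0 y0.
by apply: summable_cancel sum_E; rewrite unitrM !qprod1_unit.
Qed.

Lemma macdonald_B2 x y : x != 0 -> y != 0 ->
  theta x 0 1 * theta y 0 1 * (theta (x * y) 0 1 * theta (x / y) 0 1) =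
  psum (b2_mon x y) * (E * E).
Proof.
move=> x0 y0; have [_ ->] := macdonald_B2_family x0 y0.
exact/psumMr/summable_b2.
Qed.

End Macdonald.

(** The six positive roots of G2 are two triples of positive roots of A2, the
    short and the long ones. Multiplying the two A2 identities and collecting a
    monomial X^A Z^B leaves a sum over the indices (i, j) of the long triple. In
    this sum the exponent is four times that of an A2 identity plus a linear
    form, so that the A2 identity in base q^4, read from right to left, evaluates
    it as a product of three theta series at powers of q. *)
Section MacdonaldG2.
Variable K : numFieldType.
Local Notation sgn := (sgn K).
Local Notation psi := (psi K).
Local Notation E := (qprod (1 : K) 1 1).
Local Notation E4 := (qprod (1 : K) 4 4).

(** The theta series in base q^4 at q^s is, up to a power of q, this sign times the
    one at the residue of s modulo 4; for s divisible by 4 it vanishes. *)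
Definition vcoef (s : int) : K := if (s %% 4)%Z == 0 then 0 else sgn (s %/ 4)%Z.

(** The power of q in that reduction is q^(- w4 s). *)
Definition w4 (s : int) : int := 4 * tri (s %/ 4)%Z + (s %% 4)%Z * (s %/ 4)%Z.

Lemma w4_8 s : 8 * w4 s = s * (s - 4) +
  (if (s %% 4)%Z == 0 then 0 else if (s %% 4)%Z == 2 then 4 else 3).
Proof.
rewrite /w4; have := tri2 (s %/ 4)%Z.
have [s_r s0_ge0 s0_lt4] : [/\ s = 4 * (s %/ 4)%Z + (s %% 4)%Z,
  0 <= (s %% 4)%Z & (s %% 4)%Z < 4] by split; lia.
move: (s %/ 4)%Z (s %% 4)%Z s_r s0_ge0 s0_lt4 => r s0 -> s0_ge0 s0_lt4.
have : s0 = 0 \/ s0 = 1 \/ s0 = 2 \/ s0 = 3 by lia.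
by case=> [|[|[]]] -> /=; lia.
Qed.

Definition theta4 (s : int) : fps K := theta 1 `|(s %% 4)%Z|%N 4.

(** If none of s1, s2 and s1 + s2 is divisible by 4, then one of them is 2 modulo 4
    and the two others are odd. *)
Lemma theta4_residues (s1 s2 : int) (s3 := s1 + s2) :
  mon (sgn ((s1 %/ 4)%Z + (s2 %/ 4)%Z + (s3 %/ 4)%Z)) 0 *
    (theta4 s1 * theta4 s2 * theta4 s3) =
  mon (vcoef s1 * vcoef s2 * vcoef s3) 0 * (E4 * E ^+ 2).
Proof.
rewrite !sgnD /vcoef /theta4.
have s3E : (s3 %% 4)%Z = (((s1 %% 4)%Z + (s2 %% 4)%Z) %% 4)%Z by rewrite /s3; lia.
move: (sgn _) (sgn _) (sgn _) => e1 e2 e3; rewrite s3E.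
have := theta4_prod K; have := @theta_at0 K 4 isT; have := theta4_sym K.
have : (s1 %% 4)%Z = 0 \/ (s1 %% 4)%Z = 1 \/ (s1 %% 4)%Z = 2 \/
  (s1 %% 4)%Z = 3 by lia.
have : (s2 %% 4)%Z = 0 \/ (s2 %% 4)%Z = 1 \/ (s2 %% 4)%Z = 2 \/
  (s2 %% 4)%Z = 3 by lia.
by case=> [|[|[]]] ->; case=> [|[|[]]] -> /= sym3 at0 prod4; rewrite /= ?sym3 ?at0
  ?mulr0 ?mul0r ?mulr0 ?mon0 ?mul0r -?prod4 //; congr (_ * _); ring.
Qed.

(** The terms of the product of the three theta series at q^s1, q^s2 and
    q^(s1+s2), in the indices of the A2 identity. *)
Definition g2_term s1 s2 C (p : int * int * int) : fps K :=
  let i := p.1.1 in let j := p.1.2 in let k := p.2 in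
  mon (sgn (i + j + k)) (C + (4 * tri (i - k) + s1 * (i - k)) +
    (4 * tri (j - k) + s2 * (j - k)) + (4 * tri k + (s1 + s2) * k)).

Lemma g2_term_sum s1 s2 C : 0 <= C - w4 s1 - w4 s2 - w4 (s1 + s2) ->
  summable (g2_term s1 s2 C) /\
  psum (g2_term s1 s2 C) =
    mon (vcoef s1 * vcoef s2 * vcoef (s1 + s2))
        (C - w4 s1 - w4 s2 - w4 (s1 + s2)) * (E4 * E ^+ 2).
Proof.
move=> C_ge0; set s3 := s1 + s2; set C' := C - _ - _ - _.
have sum_t s : summable (theta_mon (1 : K) `|(s %% 4)%Z|%N 4).
  by apply: summable_theta; rewrite ?oner_eq0 //; lia.
have sum123 := summableM (summableM (sum_t s1) (sum_t s2)) (sum_t s3).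
pose h (p : int * int * int) := (p.1.1 - p.2 + (s1 %/ 4)%Z, p.1.2 - p.2 + (s2 %/ 4)%Z,
  p.2 + (s3 %/ 4)%Z).
have bij_h : bijective h.
  exists (fun p => (p.1.1 - (s1 %/ 4)%Z + (p.2 - (s3 %/ 4)%Z),
    p.1.2 - (s2 %/ 4)%Z + (p.2 - (s3 %/ 4)%Z), p.2 - (s3 %/ 4)%Z)) => -[[i j] k];
  by rewrite /h /=; congr (_, _, _); lia.
have sum_h := summable_reindex bij_h sum123.
pose c := mon (sgn ((s1 %/ 4)%Z + (s2 %/ 4)%Z + (s3 %/ 4)%Z)) C'.
have termE p : g2_term s1 s2 C p = c * ((fun q : int * int * int =>
    theta_mon (1 : K) `|(s1 %% 4)%Z|%N 4 q.1.1 *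
    theta_mon (1 : K) `|(s2 %% 4)%Z|%N 4 q.1.2 *
    theta_mon (1 : K) `|(s3 %% 4)%Z|%N 4 q.2) \o h) p.
  case: p => -[i j] k; rewrite /g2_term /h /c /theta_mon /= !exp1rz !mulr1.
  have exp_ge0 s n : 0 <= 4%:Z * tri n + `|(s %% 4)%Z|%N%:Z * n.
    by apply: theta_mon_exp_ge0; lia.
  have sgnE n : (-1) ^ n = sgn n by [].
  have nonneg s n t m u k' :=
    addr_ge0 (addr_ge0 (exp_ge0 s n) (exp_ge0 t m)) (exp_ge0 u k').
  rewrite !(monM _ _ (exp_ge0 _ _) (exp_ge0 _ _)).
  rewrite !(monM _ _ (addr_ge0 (exp_ge0 _ _) (exp_ge0 _ _)) (exp_ge0 _ _)).
  rewrite (monM _ _ C_ge0 (nonneg _ _ _ _ _ _)) !sgnE -!sgnD; congr mon.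
    by apply: sgn_eq; lia.
  rewrite /C' /w4 -/s3 !tri_add !tri_opp.
  have absE s : `|(s %% 4)%Z|%N%:Z = s - 4 * (s %/ 4)%Z by lia.
  have modE s : (s %% 4)%Z = s - 4 * (s %/ 4)%Z by lia.
  by rewrite !absE !modE; ring.
split; first by rewrite (funext termE); apply: summableMl.
rewrite (eq_psum termE) psumMl // -(psum_reindex _ bij_h).
have -> : mon (vcoef s1 * vcoef s2 * vcoef s3) C' =
    mon 1 C' * mon (vcoef s1 * vcoef s2 * vcoef s3) 0.
  by rewrite monM // mul1r addr0.
rewrite -mulrA -theta4_residues mulrA monM // mul1r addr0; congr (_ * _).
by rewrite /theta4 /theta !psumM //; apply: summableM.
Qed.

(** With M = A - 2 and N = B - 3, this is (M^2 - M N + N^2 - 7) / 12 where the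
    coefficient does not vanish: see g2_exp12. *)
Definition g2_exp (A B : int) : int :=
  a2_exp A B - w4 (A - B + 1) - w4 (2 - A) - w4 (3 - B).

Lemma g2_exp_ge0 A B : 0 <= g2_exp A B.
Proof.
have := sqr_ge0 (2 * A - B - 1); have := sqr_ge0 (B - 3); rewrite !expr2.
rewrite /g2_exp /a2_exp; have := tri2 A; have := tri2 B; have := pentw6 (A + B).
have := w4_8 (A - B + 1); have := w4_8 (2 - A); have := w4_8 (3 - B).
by repeat case: ifP => [/eqP|/eqP] ?; lia.
Qed.

Definition g2_inner A B (p : int * int) : fps K :=
  mon (psi (p.1 + p.2)) (a2_exp (A + p.1 - 2 * p.2) (B - p.1 - p.2) + a2_exp p.1 p.2).

(** Multiplied by the Euler product in base q^4, each term becomes a shifted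
    pentagonal sum over k, and the triple sum over (i, j, k) is that of
    g2_term_sum. *)
Lemma g2_inner_sum A B : ((A + B) %% 3)%Z != 2 ->
  summable (g2_inner A B) /\
  psum (g2_inner A B) =
    mon (vcoef (A - B + 1) * vcoef (2 - A) * vcoef (3 - B)) (g2_exp A B) * E ^+ 2.
Proof.
move=> AB_mod3; have s3E : 3 - B = A - B + 1 + (2 - A) by lia.
have C_ge0 := g2_exp_ge0 A B; rewrite /g2_exp s3E in C_ge0.
have [sum_g psum_g] := g2_term_sum C_ge0.
rewrite -s3E -/(g2_exp A B) in psum_g.
have inner p : psum (fun k => g2_term (A - B + 1) (2 - A) (a2_exp A B) (p, k)) =
    g2_inner A B p * E4.
  case: p => i j; rewrite /g2_inner /=.
  pose e0 := a2_exp (A + i - 2 * j) (B - i - j) + tri i + tri j + tri (i + j).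
  have -> : mon (psi (i + j)) (a2_exp (A + i - 2 * j) (B - i - j) + a2_exp i j) =
      mon (1 * psi (i + j)) (e0 - 4%:Z * pentw (i + j)).
    rewrite mul1r; have [s2|s2] := eqVneq ((i + j) %% 3)%Z 2.
      by rewrite /psi s2 /= !mon0.
    congr mon; rewrite /e0 {2}/a2_exp; have := pentw6 (i + j); have := tri2 (i + j).
    by rewrite (negPf s2); lia.
  rewrite -pent_shift //; last first.
    have := a2_exp_ge0 (A + i - 2 * j) (B - i - j); have := a2_exp_ge0 i j.
    rewrite {1}/a2_exp /e0; have := pentw6 (i + j); have := tri2 (i + j).
    by case: ifP => _; lia.
  apply: eq_psum => k; rewrite /g2_term /=; congr mon.
    by rewrite mul1r.
  rewrite /e0 /a2_exp; have := pentw6 (A + B); rewrite (negPf AB_mod3).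
  have := pentw6 (A + i - 2 * j + (B - i - j)); rewrite ifN; last by lia.
  rewrite !tri_add !tri_opp.
  have := tri2 (2 * j); have := tri2 A; have := tri2 B; have := tri2 i.
  have := tri2 j; have := tri2 k; lia.
have unit_E4 : E4 \is a GRing.unit by apply: qprod1_unit.
have sum_inner : summable (g2_inner A B).
  by apply: (summable_cancel unit_E4); rewrite -(funext inner); apply: summable_fst.
split=> //; apply: (mulIr unit_E4); rewrite -psumMr //.
by rewrite -(eq_psum inner) -psum_pair // psum_g -[RHS]mulrA [E4 * _]mulrC.
Qed.

Variables X Z : K.
Hypotheses (X0 : X != 0) (Z0 : Z != 0).

Definition g2_mon (p : int * int) : fps K :=
  mon (X ^ p.1 * Z ^ p.2 * psi (p.1 + p.2) *
    (vcoef (p.1 - p.2 + 1) * vcoef (2 - p.1) * vcoef (3 - p.2))) (g2_exp p.1 p.2).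

(** In the product of the two A2 sums, the monomial X^A Z^B comes from the indices
    (A + i - 2j, B - i - j) and (i, j). *)
Lemma macdonald_G2_family :
  summable (fun p => g2_mon p * E ^+ 2) /\
  psum (a2_mon X Z) * psum (a2_mon (Z / X) (X ^+ 2 * Z)) =
    psum (fun p => g2_mon p * E ^+ 2).
Proof.
have x0 : Z / X != 0 by rewrite mulf_neq0 ?invr_neq0.
have y0 : X ^+ 2 * Z != 0 by rewrite mulf_neq0 ?expf_neq0.
have sum_a2 := summableM (summable_a2 X0 Z0) (summable_a2 x0 y0).
rewrite psumM; try exact: summable_a2.
pose h (p : int * int * (int * int)) :=
  (p.1.1 + p.2.1 - 2 * p.2.2, p.1.2 - p.2.1 - p.2.2, p.2).
have bij_h : bijective h.
  exists (fun p => (p.1.1 - p.2.1 + 2 * p.2.2, p.1.2 + p.2.1 + p.2.2, p.2)) =>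
    -[[m n] [i j]]; by rewrite /h /=; congr (_, _, _); lia.
have sum_h := summable_reindex bij_h sum_a2.
rewrite (psum_reindex _ bij_h) (psum_pair sum_h).
have inner p : psum (fun k => ((fun q : int * int * (int * int) => a2_mon X Z q.1 *
    a2_mon (Z / X) (X ^+ 2 * Z) q.2) \o h) (p, k)) = g2_mon p * E ^+ 2.
  case: p => A B.
  have termE k : ((fun q : int * int * (int * int) => a2_mon X Z q.1 *
    a2_mon (Z / X) (X ^+ 2 * Z) q.2) \o h) ((A, B), k) =
    mon (X ^ A * Z ^ B * psi (A + B)) 0 * g2_inner A B k.
    case: k => i j; rewrite /h /a2_mon /g2_inner /=.
    rewrite (monM _ _ (a2_exp_ge0 _ _) (a2_exp_ge0 _ _)).
    rewrite (monM _ _ (lexx 0) (addr_ge0 (a2_exp_ge0 _ _) (a2_exp_ge0 _ _))) add0r.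
    congr mon.
    have -> : psi (A + i - 2 * j + (B - i - j)) = psi (A + B).
      by rewrite /psi (_ : (_ %% 3)%Z = ((A + B) %% 3)%Z); last lia.
    have -> : (Z / X) ^ i = Z ^ i / X ^ i by rewrite expfzMl exprz_inv -invr_expz.
    have -> : (X ^+ 2 * Z) ^ j = X ^ j * X ^ j * Z ^ j.
      by rewrite expfzMl expr2 expfzMl.
    have -> : X ^ (A + i - 2 * j) = X ^ A * X ^ i / (X ^ j * X ^ j).
      rewrite (_ : A + i - 2 * j = A + i - (j + j)); last by lia.
      by rewrite !expfzDr // -invr_expz expfzDr.
    have -> : Z ^ (B - i - j) = Z ^ B / (Z ^ i * Z ^ j).
      by rewrite -addrA -opprD expfzDr // -invr_expz expfzDr.
    by field; rewrite !expfz_neq0.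
  rewrite (eq_psum termE) /g2_mon /=.
  have [AB2|AB2] := eqVneq ((A + B) %% 3)%Z 2.
    have -> : psi (A + B) = 0 by rewrite /psi AB2.
    by under eq_psum do rewrite mulr0 mon0 mul0r; rewrite mulr0 !mul0r mon0 mul0r;
       apply: fpsP => m; apply: coef_psum0.
  have [sum_I psum_I] := g2_inner_sum AB2.
  by rewrite psumMl // psum_I mulrA monM ?g2_exp_ge0 // add0r.
by split; [rewrite -(funext inner); apply: summable_fst | apply: eq_psum].
Qed.

Lemma summable_g2 : summable g2_mon.
Proof.
have [sum_E _] := macdonald_G2_family.
by apply: summable_cancel sum_E; rewrite unitrX ?qprod1_unit.
Qed.

Lemma macdonald_G2 :
  theta X 0 1 * theta Z 0 1 * theta (X * Z) 0 1 *
    (theta (Z / X) 0 1 * theta (X ^+ 2 * Z) 0 1 * theta (X * Z ^+ 2) 0 1) =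
  psum g2_mon * E ^+ 4.
Proof.
have x0 : Z / X != 0 by rewrite mulf_neq0 ?invr_neq0.
have y0 : X ^+ 2 * Z != 0 by rewrite mulf_neq0 ?expf_neq0.
have -> : X * Z ^+ 2 = (Z / X) * (X ^+ 2 * Z) by field.
rewrite !macdonald_A2 // mulrACA; have [_ ->] := macdonald_G2_family.
by rewrite psumMr ?summable_g2; [ring | apply: summable_g2].
Qed.

End MacdonaldG2.

(** * Anisotropic binary forms modulo a prime *)

(** Here a^3 = - b^3; as k is odd, comparing a^(3k+2) = a and b^(3k+2) = b gives
    ab(a + b) = 0. *)
Lemma eisenstein_field (F : fieldType) (k : nat) (a b : F) :
  odd k -> a ^+ (3 * k + 2) = a -> b ^+ (3 * k + 2) = b -> (3 : F) != 0 ->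
  a * a - a * b + b * b = 0 -> a = 0 /\ b = 0.
Proof.
rewrite !(exprD _ (3 * k) 2) !(exprM _ 3) => k_odd fa fb three_neq0 ab0.
have a3 : a ^+ 3 = - b ^+ 3.
  apply/eqP; rewrite -subr_eq0 opprK; apply/eqP.
  have -> : a ^+ 3 + b ^+ 3 = (a + b) * (a * a - a * b + b * b) by ring.
  by rewrite ab0 mulr0.
have ab_sum0 : a * b * (a + b) = 0.
  move: fa; rewrite a3 exprNn -signr_odd k_odd expr1 => fa.
  have e : a * b ^+ 2 = - (a ^+ 2 * b) by rewrite -[in LHS]fa -[in RHS]fb; ring.
  have -> : a * b * (a + b) = a * b ^+ 2 + a ^+ 2 * b by ring.
  by rewrite e addNr.
have sq0 (x : F) : x * x = 0 -> x = 0 by move/eqP; rewrite mulf_eq0 orbb => /eqP.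
move/eqP: ab_sum0; rewrite !mulf_eq0 -orbA => /or3P[]/eqP.
- by move=> a0; move: ab0; rewrite a0 !mul0r subrr add0r => /sq0->.
- by move=> b0; move: ab0; rewrite b0 !mulr0 subr0 addr0 => /sq0->.
move/eqP; rewrite addr_eq0 => /eqP a_b; move: ab0; rewrite a_b.
have -> : - b * - b - - b * b + b * b = 3 * (b * b) by ring.
by move/eqP; rewrite mulf_eq0 (negPf three_neq0) => /eqP/sq0->; rewrite oppr0.
Qed.

(** Here a^2 = - b^2, and comparing the two Frobenius equations gives 2ab = 0. *)
Lemma gauss_field (F : fieldType) (k : nat) (a b : F) :
  a ^+ (2 * (2 * k + 1)).+1 = a -> b ^+ (2 * (2 * k + 1)).+1 = b ->
  (2 : F) != 0 -> a * a + b * b = 0 -> a = 0 /\ b = 0.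
Proof.
rewrite !(exprS _ (2 * _)) !(exprM _ 2) => fa fb two_neq0 ab0.
have a2 : a ^+ 2 = - b ^+ 2.
  by apply/eqP; rewrite -subr_eq0 opprK !expr2 ab0.
have ab_double0 : 2 * (a * b) = 0.
  move: fa; rewrite a2 exprNn -signr_odd oddD oddM /= expr1 => fa.
  have e : a * b = - (a * b) by rewrite -[in LHS]fa -[in RHS]fb; ring.
  by rewrite mulr_natl mulr2n {2}e subrr.
have sq0 (x : F) : x * x = 0 -> x = 0 by move/eqP; rewrite mulf_eq0 orbb => /eqP.
move/eqP: ab_double0; rewrite !mulf_eq0 (negPf two_neq0) /= => /orP[]/eqP.
  by move=> a0; move: ab0; rewrite a0 mul0r add0r => /sq0->.
by move=> b0; move: ab0; rewrite b0 mulr0 addr0 => /sq0->.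
Qed.

(** The prime field is treated as an abstract field in which x^p = x. *)
Section PrimeField.
Variables (F : fieldType) (p : nat).
Hypotheses (pcharF : p \in [pchar F]) (frobF : forall x : F, x ^+ p = x).

Let p_pr : prime p := pcharf_prime pcharF.

Let natF_neq0 n : (0 < n < p)%N -> n%:R != 0 :> F.
Proof. by case/andP=> n0 lt_np; rewrite -(dvdn_pcharf pcharF) gtnNdvd. Qed.

Lemma eisenstein_pchar (a b : int) : (p %% 3 = 2)%N -> (2 < p)%N ->
  (p %| a * a - a * b + b * b)%Z -> (p %| a)%Z /\ (p %| b)%Z.
Proof.
move=> p3 p_gt2; rewrite !(dvdz_pcharf pcharF) rmorphD rmorphB !rmorphM /=.
have [k def_p k_odd] : exists2 k, p = (3 * k + 2)%N & odd k.
  exists (p %/ 3)%N; first lia.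
  by have := even_prime p_pr; lia.
have frob (x : F) : x ^+ (3 * k + 2) = x by rewrite -def_p.
have three_neq0 : 3 != 0 :> F by apply: natF_neq0; lia.
by move=> /eqP/(eisenstein_field k_odd (frob _) (frob _) three_neq0)[-> ->].
Qed.

Lemma gauss_pchar (a b : int) : (p %% 4 = 3)%N ->
  (p %| a * a + b * b)%Z -> (p %| a)%Z /\ (p %| b)%Z.
Proof.
move=> p4; rewrite !(dvdz_pcharf pcharF) rmorphD !rmorphM /=.
have [k def_p] : exists k, p = (2 * (2 * k + 1)).+1.
  by exists (p %/ 4)%N; lia.
have frob (x : F) : x ^+ (2 * (2 * k + 1)).+1 = x by rewrite -def_p.
have two_neq0 : 2 != 0 :> F by apply: natF_neq0; lia.
by move=> /eqP/(gauss_field (frob _) (frob _) two_neq0)[-> ->].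
Qed.

End PrimeField.

Lemma frobenius_Fp (p : nat) (x : 'F_p) : prime p -> x ^+ p = x.
Proof. by move=> p_pr; have := expf_card x; rewrite card_Fp. Qed.

Lemma eisenstein_anisotropic (p : nat) (a b : int) :
  prime p -> (p %% 3 = 2)%N -> (2 < p)%N ->
  (p %| a * a - a * b + b * b)%Z -> (p %| a)%Z /\ (p %| b)%Z.
Proof.
by move=> pr; apply: (eisenstein_pchar (pchar_Fp pr)) => x; apply: frobenius_Fp.
Qed.

Lemma gauss_anisotropic (p : nat) (a b : int) :
  prime p -> (p %% 4 = 3)%N ->
  (p %| a * a + b * b)%Z -> (p %| a)%Z /\ (p %| b)%Z.
Proof.
by move=> pr; apply: (gauss_pchar (pchar_Fp pr)) => x; apply: frobenius_Fp.
Qed.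

(** * Vanishing coefficients at roots of unity *)

Section Vanishing.
Variable K : numFieldType.
Implicit Types x y : K.
Local Notation E := (qprod (1 : K) 1 1).
Local Notation sgn := (sgn K).
Local Notation psi := (psi K).

(** Each term is a product of an unsigned monomial u in the roots of unity and an
    antisymmetric sign w. *)
Lemma coef_mon_antisym (u u' w w' : K) (e e' : int) (m : nat) :
  w' = - w -> (w != 0 -> e' = e) -> (w != 0 -> e = m%:Z -> u' = u) ->
  fps_coef (mon (u' * w') e') m = - fps_coef (mon (u * w) e) m.
Proof.
move=> -> ee' uu'; rewrite !coef_mon.
have [->|w_neq0] := eqVneq w 0; first by rewrite oppr0 !mulr0 !if_same oppr0.
rewrite ee' //; case: (e =P m%:Z) => [em|_]; last by rewrite oppr0.
by rewrite uu' // mulrN.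
Qed.

Variables (l : nat) (l_prime : prime l) (l_ge5 : (5 <= l)%N).

Lemma expz_period x (n k : int) : x ^+ l = 1 -> (l %| n - k)%Z -> x ^ n = x ^ k.
Proof.
move=> xl1 /dvdzP[d def_n]; have x_neq0 : x != 0.
  apply/eqP => x0; move: xl1; rewrite x0 expr0n.
  by case: (l) l_ge5 => // n' _ /eqP; rewrite eq_sym oner_eq0.
have -> : n = k + l%:Z * d by rewrite mulrC -def_n addrC subrK.
by rewrite expfzDr // -exprz_exp -exprnP xl1 exp1rz mulr1.
Qed.

Lemma root1_neq0 x : x ^+ l = 1 -> x != 0.
Proof.
move=> xl1; apply/eqP => x0; move: xl1; rewrite x0 expr0n.
by case: (l) l_ge5 => // n' _ /eqP; rewrite eq_sym oner_eq0.
Qed.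

Lemma tri_refl n : tri (1 - n) = tri n.
Proof. by have := tri2 (1 - n); have := tri2 n; lia. Qed.

Lemma sgn_refl n : sgn (1 - n) = - sgn n.
Proof. by rewrite sgnD sgn1 mulN1r; congr (- _); apply: sgn_eq; lia. Qed.

Lemma cancel_small c (a : int) : (0 < c < l)%N -> (l %| c%:Z * a)%Z -> (l %| a)%Z.
Proof.
move=> c_lt; rewrite Gauss_dvdzr // coprimezE /=.
by rewrite prime_coprime // gtnNdvd //; case/andP: c_lt.
Qed.

Lemma theta_mon_refl x (m : nat) (n : int) (b : K) (e : int) :
  b != 0 -> x ^+ l = 1 ->
  (e + tri n = m%:Z -> (l %| 2 * n - 1)%Z) ->
  fps_coef (mon (x ^ (1 - n) * (b * sgn (1 - n))) (e + tri (1 - n))) m =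
  - fps_coef (mon (x ^ n * (b * sgn n)) (e + tri n)) m.
Proof.
move=> b0 xl1 l_dvd; apply: coef_mon_antisym.
- by rewrite sgn_refl mulrN.
- by rewrite tri_refl.
move=> _ /l_dvd l_n; apply: expz_period => //.
by rewrite (_ : 1 - n - n = - (2 * n - 1)); [rewrite rpredN | lia].
Qed.

Lemma psi_refl s : psi (4 - s) = - psi s.
Proof.
rewrite /psi; have : (s %% 3)%Z = 0 \/ (s %% 3)%Z = 1 \/ (s %% 3)%Z = 2 by lia.
case=> [|[]] s0; rewrite s0.
- by rewrite (_ : ((4 - s) %% 3)%Z = 1); last lia.
- by rewrite (_ : ((4 - s) %% 3)%Z = 0) ?opprK; last lia.
- by rewrite (_ : ((4 - s) %% 3)%Z = 2) /= ?oppr0; last lia.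
Qed.

Lemma psi_neq0 s : psi s != 0 -> ((s %% 3)%Z == 2) = false.
Proof. by case: ((s %% 3)%Z =P 2) => // s2; rewrite /psi s2 /= eqxx. Qed.

(** If l divides 24m + 8, the exponents of the terms of degree m make the norm form
    of (a - 1, b - 1) divisible by l. Both coordinates are then multiples of l,
    so that the powers of x and y are the same for (a, b) and (2 - a, 2 - b),
    whereas the sign changes. The next lemmas follow the same pattern. *)
Lemma coef_a2 x y (m : nat) : (l %% 3 = 2)%N -> x ^+ l = 1 -> y ^+ l = 1 ->
  (l %| 24 * m + 8)%N -> fps_coef (psum (a2_mon x y)) m = 0.
Proof.
move=> l3 xl yl l_m.
apply: (@coef_psum_antisym _ _ (fun p : int * int => (2 - p.1, 2 - p.2))).
- by exists (fun p : int * int => (2 - p.1, 2 - p.2)) => -[a b] /=; congr (_, _); lia.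
- by apply: summable_a2; apply: root1_neq0.
case=> a b; rewrite /a2_mon /=.
have sE : 2 - a + (2 - b) = 4 - (a + b) by lia.
apply: coef_mon_antisym; rewrite ?sE ?psi_refl // => /psi_neq0 s_neq2.
  rewrite /a2_exp sE; have := pentw6 (a + b); have := pentw6 (4 - (a + b)).
  rewrite s_neq2 ifN; last by lia.
  by have := tri2 a; have := tri2 b; have := tri2 (2 - a); have := tri2 (2 - b); lia.
move=> e_m; have [la lb] : (l %| a - 1)%Z /\ (l %| b - 1)%Z.
  apply: eisenstein_anisotropic => //; first by apply: leq_trans l_ge5.
  do 3![apply: (@cancel_small 2); first by lia].
  suff -> : 2%:Z * (2%:Z * (2%:Z * ((a - 1) * (a - 1) - (a - 1) * (b - 1) +
    (b - 1) * (b - 1)))) = (24 * m + 8)%N%:Z by [].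
  move: e_m; rewrite /a2_exp; have := pentw6 (a + b); rewrite s_neq2.
  by have := tri2 a; have := tri2 b; lia.
congr (_ * _); apply: expz_period => //.
  by rewrite (_ : 2 - a - a = - (2 * (a - 1))); [rewrite rpredN dvdz_mull | lia].
by rewrite (_ : 2 - b - b = - (2 * (b - 1))); [rewrite rpredN dvdz_mull | lia].
Qed.

(** Changing the sign of 2a - 3 exchanges the arguments s and s' of psi, up to
    s -> 4 - s, and changes the parity in the sign. *)
Lemma coef_b2 x y (m : nat) : (l %% 4 = 3)%N -> x ^+ l = 1 -> y ^+ l = 1 ->
  (l %| 24 * m + 10)%N -> fps_coef (psum (b2_mon x y)) m = 0.
Proof.
move=> l4 xl yl l_m.
apply: (@coef_psum_antisym _ _ (fun p : int * int => (3 - p.1, p.2))).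
- by exists (fun p : int * int => (3 - p.1, p.2)) => -[a b] /=; congr (_, _); lia.
- by apply: summable_b2; apply: root1_neq0.
case=> a b; pose w s s' := psi s * (sgn s' * psi s').
have b2E c d : b2_mon x y (c, d) =
    mon (x ^ c * y ^ d * w (c + d) (c - d + 1)) (b2_exp c d).
  by rewrite /b2_mon /w /= -mulrA.
rewrite !b2E /w /=; have sE : 3 - a + b = 4 - (a - b + 1) by lia.
have s'E : 3 - a - b + 1 = 4 - (a + b) by lia.
apply: coef_mon_antisym; rewrite ?sE ?s'E.
- rewrite !psi_refl (_ : sgn (4 - (a + b)) = - sgn (a - b + 1)); first by ring.
  by rewrite -sgn_refl; apply: sgn_eq; lia.
- rewrite !mulf_eq0 !negb_or => /and3P[/psi_neq0 s2 _ /psi_neq0 s'2].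
  rewrite /b2_exp sE s'E; have := pentw6 (a + b); have := pentw6 (4 - (a + b)).
  have := pentw6 (a - b + 1); have := pentw6 (4 - (a - b + 1)).
  rewrite s2 s'2 !ifN; try by lia.
  by have := tri2 a; have := tri2 b; have := tri2 (3 - a); lia.
rewrite !mulf_eq0 !negb_or => /and3P[/psi_neq0 s2 _ /psi_neq0 s'2] e_m.
have [la _] : (l %| 2 * a - 3)%Z /\ (l %| 2 * b - 1)%Z.
  apply: gauss_anisotropic => //.
  suff -> : (2 * a - 3) * (2 * a - 3) + (2 * b - 1) * (2 * b - 1) =
    (24 * m + 10)%N%:Z by [].
  move: e_m; rewrite /b2_exp; have := pentw6 (a + b); have := pentw6 (a - b + 1).
  by rewrite s2 s'2; have := tri2 a; have := tri2 b; lia.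
congr (_ * _); apply: expz_period => //.
by rewrite (_ : 3 - a - a = - (2 * a - 3)); [rewrite rpredN | lia].
Qed.

Lemma vcoef_opp s : vcoef K (- s) = - vcoef K s.
Proof.
rewrite /vcoef; have [s0|s_neq0] := eqVneq (s %% 4)%Z 0.
  by rewrite (_ : ((- s) %% 4)%Z = 0) ?eqxx ?oppr0 //; lia.
rewrite ifN; last by lia.
by rewrite -sgn_refl; apply: sgn_eq; lia.
Qed.

Lemma vcoef_neq0 s : vcoef K s != 0 -> (s %% 4)%Z != 0.
Proof. by rewrite /vcoef; case: ifP => // _; rewrite eqxx. Qed.

Lemma g2_exp12 A B : ((A + B) %% 3)%Z != 2 -> ((A - B + 1) %% 4)%Z != 0 ->
  ((2 - A) %% 4)%Z != 0 -> ((3 - B) %% 4)%Z != 0 ->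
  12 * g2_exp A B + 7 = (A - 2) * (A - 2) - (A - 2) * (B - 3) + (B - 3) * (B - 3).
Proof.
move=> AB3 s1 s2 s3; rewrite /g2_exp /a2_exp; have := tri2 A; have := tri2 B.
have := pentw6 (A + B); rewrite (negPf AB3).
have := w4_8 (A - B + 1); have := w4_8 (2 - A); have := w4_8 (3 - B).
rewrite (negPf s1) (negPf s2) (negPf s3).
by case: eqP => ?; case: eqP => ?; case: eqP => ?; lia.
Qed.

(** Here -1 is an even element of the Weyl group and does not change the sign, but
    the exchange of A - 2 and B - 3 is a reflection. *)
Lemma coef_g2 (X Z : K) (m : nat) : (l %% 3 = 2)%N -> X ^+ l = 1 -> Z ^+ l = 1 ->
  (l %| 24 * m + 14)%N -> fps_coef (psum (g2_mon X Z)) m = 0.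
Proof.
move=> l3 Xl Zl l_m.
apply: (@coef_psum_antisym _ _ (fun p : int * int => (p.2 - 1, p.1 + 1))).
- by exists (fun p : int * int => (p.2 - 1, p.1 + 1)) => -[a b] /=; congr (_, _); lia.
- by apply: summable_g2; apply: root1_neq0.
case=> A B; pose w (A B : int) := psi (A + B) *
  (vcoef K (A - B + 1) * vcoef K (2 - A) * vcoef K (3 - B)).
have g2E C D : g2_mon X Z (C, D) = mon (X ^ C * Z ^ D * w C D) (g2_exp C D).
  by rewrite /g2_mon /w /= -mulrA.
rewrite !g2E /=.
have sumE : B - 1 + (A + 1) = A + B by lia.
have s1E : B - 1 - (A + 1) + 1 = - (A - B + 1) by lia.
have s2E : 2 - (B - 1) = 3 - B by lia.
have s3E : 3 - (A + 1) = 2 - A by lia.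
apply: coef_mon_antisym.
- by rewrite /w sumE s1E s2E s3E vcoef_opp; ring.
- rewrite /w !mulf_eq0 !negb_or -andbA.
  case/and4P=> /psi_neq0/negbT AB3 /vcoef_neq0 s1 /vcoef_neq0 s2 /vcoef_neq0 s3.
  have := g2_exp12 AB3 s1 s2 s3; have := @g2_exp12 (B - 1) (A + 1).
  have s1' : ((- (A - B + 1)) %% 4)%Z != 0 by lia.
  by rewrite sumE s1E s2E s3E => /(_ AB3 s1' s3 s2); lia.
rewrite /w !mulf_eq0 !negb_or -andbA.
case/and4P=> /psi_neq0/negbT AB3 /vcoef_neq0 s1 /vcoef_neq0 s2 /vcoef_neq0 s3 e_m.
have [lA lB] : (l %| A - 2)%Z /\ (l %| B - 3)%Z.
  apply: eisenstein_anisotropic => //; first by apply: leq_trans l_ge5.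
  apply: (@cancel_small 2); first by lia.
  rewrite -g2_exp12 // e_m.
  by suff -> : 2%:Z * (12 * m%:Z + 7) = (24 * m + 14)%N%:Z by []; lia.
congr (_ * _); apply: expz_period => //.
  by rewrite (_ : B - 1 - A = (B - 3) - (A - 2)); [rewrite rpredB | lia].
by rewrite (_ : A + 1 - B = (A - 2) - (B - 3)); [rewrite rpredB | lia].
Qed.

Lemma coef_theta_theta x y (m : nat) : (l %% 4 = 3)%N -> x ^+ l = 1 -> y ^+ l = 1 ->
  (l %| 24 * m + 6)%N -> fps_coef (theta x 0 1 * theta y 0 1) m = 0.
Proof.
move=> l4 xl yl l_m; have [x0 y0] := (root1_neq0 xl, root1_neq0 yl).
rewrite /theta psumM; try exact: summable_theta01.
apply: (@coef_psum_antisym _ _ (fun p : int * int => (p.1, 1 - p.2))).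
- by exists (fun p : int * int => (p.1, 1 - p.2)) => -[a b] /=; congr (_, _); lia.
- by apply: summableM; apply: summable_theta01.
case=> a b; rewrite /= !theta_mon01 !monM ?tri_ge0 //.
have grp c : sgn a * x ^ a * (sgn c * y ^ c) =
  y ^ c * (sgn a * x ^ a * sgn c) by ring.
rewrite !grp; apply: theta_mon_refl => //.
  by rewrite mulf_neq0 ?sgn_neq0 ?expfz_neq0.
move=> e_m; suff [] : (l %| 2 * b - 1)%Z /\ (l %| 2 * a - 1)%Z by [].
apply: gauss_anisotropic => //; apply: (@cancel_small 3); first by lia.
suff -> : 3%:Z * ((2 * b - 1) * (2 * b - 1) + (2 * a - 1) * (2 * a - 1)) =
  (24 * m + 6)%N%:Z by [].
by have := tri2 a; have := tri2 b; lia.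
Qed.

(** The form is M^2 + 3 N^2 with M = 6a - 1 and N = 2b - 1, which is the Eisenstein
    form at (M + N, 2N). *)
Lemma coef_euler_theta x (m : nat) : (l %% 3 = 2)%N -> x ^+ l = 1 ->
  (l %| 24 * m + 4)%N -> fps_coef (E * theta x 0 1) m = 0.
Proof.
move=> l3 xl l_m; have x0 := root1_neq0 xl.
have sum13 : summable (theta_mon (1 : K) 1 3).
  by apply: summable_theta; rewrite ?oner_eq0.
rewrite -(@euler_pentagonal K 1) // /theta psumM //; last exact: summable_theta01.
apply: (@coef_psum_antisym _ _ (fun p : int * int => (p.1, 1 - p.2))).
- by exists (fun p : int * int => (p.1, 1 - p.2)) => -[a b] /=; congr (_, _); lia.
- by apply: summableM => //; apply: summable_theta01.
case=> a b; rewrite /= !theta_mon01 /theta_mon exp1rz mulr1.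
have e_ge0 : 0 <= 3%:Z * tri a + 1%:Z * a by apply: theta_mon_exp_ge0.
rewrite !(monM _ _ e_ge0 (tri_ge0 _)).
have grp c : (-1) ^ a * (sgn c * x ^ c) = x ^ c * (sgn a * sgn c).
  by rewrite -/(sgn a); ring.
rewrite !grp; apply: theta_mon_refl; rewrite ?sgn_neq0 // => e_m.
suff [_] : (l %| (6 * a - 1) + (2 * b - 1))%Z /\ (l %| 2 * (2 * b - 1))%Z.
  by apply: cancel_small; lia.
apply: eisenstein_anisotropic => //; first by apply: leq_trans l_ge5.
suff -> : (6 * a - 1 + (2 * b - 1)) * (6 * a - 1 + (2 * b - 1)) -
  (6 * a - 1 + (2 * b - 1)) * (2 * (2 * b - 1)) +
  2 * (2 * b - 1) * (2 * (2 * b - 1)) = (24 * m + 4)%N%:Z by [].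
by have := tri2 a; have := tri2 b; lia.
Qed.

End Vanishing.

(** * Theta blocks *)

Section ThetaBlocks.
Variable K : numFieldType.
Implicit Types x y : K.
Local Notation E := (qprod (1 : K) 1 1).

Lemma coef_mon0M (c : K) f m : fps_coef (mon c 0 * f) m = c * fps_coef f m.
Proof.
have -> : mon c 0 = fps_const c by rewrite -(const_qX c 0) expr0 mulr1.
exact: (coef_fps_constM c f).
Qed.

Lemma mon0_eq0 (c : K) f m :
  c != 0 -> fps_coef (mon c 0 * f) m = 0 -> fps_coef f m = 0.
Proof. by rewrite coef_mon0M => c0 /eqP; rewrite mulf_eq0 (negPf c0) => /eqP. Qed.

Lemma mon0M (c d : K) : mon (c * d) 0 = mon c 0 * mon d 0.
Proof. by rewrite monM // addr0. Qed.

Definition qpair x : fps K := qprod x 1 1 * qprod x^-1 1 1.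

Lemma qpairV x : qpair x^-1 = qpair x.
Proof. by rewrite /qpair invrK mulrC. Qed.

Lemma qpair1 : qpair 1 = E ^+ 2.
Proof. by rewrite /qpair invr1. Qed.

Lemma qpair_unit x : qpair x \is a GRing.unit.
Proof. by rewrite unitrM !qprod_unit. Qed.

Lemma theta_qpair x : x != 0 -> theta x 0 1 = mon (1 - x) 0 * (qpair x * E).
Proof. exact: jacobi_triple_product0. Qed.

Let unit_E : E \is a GRing.unit. Proof. exact: qprod_unit. Qed.

Variables (l : nat) (l_prime : prime l) (l_ge5 : (5 <= l)%N).
Variable m : nat.

(** In these blocks the constant factors 1 - x are cancelled, which is why no
    argument may be 1. *)
Lemma coef_block4 x : (l %% 3 = 2)%N -> x ^+ l = 1 -> x != 1 ->
  (l %| 24 * m + 4)%N -> fps_coef (E ^+ 2 * qpair x) m = 0.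
Proof.
move=> l3 xl x1 l_m; apply: (@mon0_eq0 (1 - x)); first by rewrite subr_eq0 eq_sym.
rewrite -[RHS](coef_euler_theta l_prime l_ge5 l3 xl l_m).
rewrite theta_qpair ?(root1_neq0 l_ge5 xl) //; congr (fps_coef _ _); ring.
Qed.

Lemma coef_block6 x y : (l %% 4 = 3)%N -> x ^+ l = 1 -> y ^+ l = 1 ->
  x != 1 -> y != 1 -> (l %| 24 * m + 6)%N ->
  fps_coef (E ^+ 2 * (qpair x * qpair y)) m = 0.
Proof.
move=> l4 xl yl x1 y1 l_m; apply: (@mon0_eq0 ((1 - x) * (1 - y))).
  by rewrite mulf_neq0 // subr_eq0 eq_sym.
rewrite -[RHS](coef_theta_theta l_prime l_ge5 l4 xl yl l_m).
rewrite !theta_qpair ?(root1_neq0 l_ge5 xl) ?(root1_neq0 l_ge5 yl) // mon0M.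
congr (fps_coef _ _); ring.
Qed.

Lemma coef_block8 x y : (l %% 3 = 2)%N -> x ^+ l = 1 -> y ^+ l = 1 ->
  x != 1 -> y != 1 -> x * y != 1 -> (l %| 24 * m + 8)%N ->
  fps_coef (E ^+ 2 * (qpair x * qpair y * qpair (x * y))) m = 0.
Proof.
move=> l3 xl yl x1 y1 xy1 l_m; apply: (@mon0_eq0 ((1 - x) * (1 - y) * (1 - x * y))).
  by rewrite !mulf_neq0 // subr_eq0 eq_sym.
rewrite -[RHS](coef_a2 l_prime l_ge5 l3 xl yl l_m); congr (fps_coef _ _).
have [x0 y0] := (root1_neq0 l_ge5 xl, root1_neq0 l_ge5 yl).
apply: (mulIr unit_E); rewrite -macdonald_A2 // !theta_qpair ?mulf_neq0 // !mon0M.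
ring.
Qed.

Lemma coef_block10 x y : (l %% 4 = 3)%N -> x ^+ l = 1 -> y ^+ l = 1 ->
  x != 1 -> y != 1 -> x * y != 1 -> x / y != 1 -> (l %| 24 * m + 10)%N ->
  fps_coef (E ^+ 2 * (qpair x * qpair y * (qpair (x * y) * qpair (x / y)))) m = 0.
Proof.
move=> l4 xl yl x1 y1 xy1 xVy1 l_m.
apply: (@mon0_eq0 ((1 - x) * (1 - y) * ((1 - x * y) * (1 - x / y)))).
  by rewrite !mulf_neq0 // subr_eq0 eq_sym.
rewrite -[RHS](coef_b2 l_prime l_ge5 l4 xl yl l_m); congr (fps_coef _ _).
have [x0 y0] := (root1_neq0 l_ge5 xl, root1_neq0 l_ge5 yl).
have unit_EE : E * E \is a GRing.unit by rewrite unitrM unit_E.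
apply: (mulIr unit_EE); rewrite -macdonald_B2 //.
rewrite !theta_qpair ?mulf_neq0 ?invr_neq0 // !mon0M; ring.
Qed.

Lemma coef_block14 (X Z : K) : (l %% 3 = 2)%N -> X ^+ l = 1 -> Z ^+ l = 1 ->
  X != 1 -> Z != 1 -> X * Z != 1 -> Z / X != 1 -> X ^+ 2 * Z != 1 ->
  X * Z ^+ 2 != 1 -> (l %| 24 * m + 14)%N ->
  fps_coef (E ^+ 2 * (qpair X * qpair Z * qpair (X * Z) *
    (qpair (Z / X) * qpair (X ^+ 2 * Z) * qpair (X * Z ^+ 2)))) m = 0.
Proof.
move=> l3 Xl Zl X1 Z1 XZ1 ZVX1 XXZ1 XZZ1 l_m.
apply: (@mon0_eq0 ((1 - X) * (1 - Z) * (1 - X * Z) *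
  ((1 - Z / X) * (1 - X ^+ 2 * Z) * (1 - X * Z ^+ 2)))).
  by rewrite !mulf_neq0 // subr_eq0 eq_sym.
rewrite -[RHS](coef_g2 l_prime l_ge5 l3 Xl Zl l_m); congr (fps_coef _ _).
have [X0 Z0] := (root1_neq0 l_ge5 Xl, root1_neq0 l_ge5 Zl).
have unit_E4 : E ^+ 4 \is a GRing.unit by rewrite unitrX.
apply: (mulIr unit_E4); rewrite -macdonald_G2 //.
rewrite !theta_qpair ?mulf_neq0 ?invr_neq0 ?expf_neq0 // !mon0M; ring.
Qed.

End ThetaBlocks.

(** * Cranks over an arbitrary ring *)

Section Crank.
Variables (R : comUnitRingType) (z : R).
Local Notation q := (fps_q R).

(** The same series over any ring, so that zeta can be replaced by a complex root
    of unity. *)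
Definition gcrank_factor (a : int) (n : nat) : fps R :=
  (1 - q ^+ n) /
  ((1 - fps_const (z ^ a) * q ^+ n) * (1 - fps_const (z ^ (- a)) * q ^+ n)).

Definition gcrank (a : int) : fps R := fps_infprod (gcrank_factor a).

Definition gcrank_multi (k : nat) (a : nat -> int) : fps R :=
  gcrank 0 ^+ (k - odd k)./2 * \prod_(i < (k + odd k)./2) gcrank (a i).

Definition gcrank_k (k : nat) : fps R := gcrank_multi k (crank_mult k).

Lemma one_upto_q : @one_upto R (fun n => 1 - q ^+ n).
Proof.
move=> n i lt_in; rewrite -[q ^+ n]mul1r.
exact: (coef_fps_1sub_small 1 lt_in).
Qed.

Lemma one_upto_factor (c : R) : one_upto (fun n => 1 - fps_const c * q ^+ n).
Proof. by move=> n i lt_in; apply: (coef_fps_1sub_small c lt_in). Qed.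

Lemma one_upto_crank a : one_upto (gcrank_factor a).
Proof.
move=> n; apply: coef_fps_mul_small; first exact: one_upto_q.
apply: coef_fps_inv_small.
by apply: coef_fps_mul_small; apply: one_upto_factor.
Qed.

Lemma qprod11E (x : R) :
  qprod x 1 1 = fps_infprod (fun n => 1 - fps_const x * q ^+ n).
Proof.
by apply: eq_infprod => n n_gt0; rewrite const_qX mul1n add1n prednK.
Qed.

Lemma gcrankE a :
  gcrank a * (qprod (z ^ a) 1 1 * qprod (z ^ (- a)) 1 1) = qprod 1 1 1.
Proof.
have upto2 : one_upto (fun n => (1 - fps_const (z ^ a) * q ^+ n) *
    (1 - fps_const (z ^ (- a)) * q ^+ n)).
  by move=> n; apply: coef_fps_mul_small; apply: one_upto_factor.
rewrite !qprod11E (infprodM (@one_upto_factor _) (@one_upto_factor _)).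
rewrite /gcrank (infprodM (@one_upto_crank a) upto2).
apply: eq_infprod => n n_gt0; rewrite /gcrank_factor divrK.
  by rewrite [fps_const 1 * _](_ : _ = q ^+ n) //; apply: mul1r.
by apply: fps_unit1; rewrite upto2.
Qed.

End Crank.

Lemma crank_kE k : crank_k k = gcrank_k zeta k.
Proof. by []. Qed.

(** * Reduction at a root of unity *)

Section RootOfUnity.
Variable K : numFieldType.
Local Notation E := (qprod (1 : K) 1 1).

(** Named as a function, so as to carry its ring morphism structure. *)
Definition mon_const (c : K) : fps K := mon c 0.

Fact mon_const_zmod : zmod_morphism mon_const.
Proof.
move=> c d; apply: fpsP => m; rewrite fps_coefD fps_coefN !coef_mon.
by case: ifP; rewrite ?subrr.
Qed.
Fact mon_const_monoid : monoid_morphism mon_const.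
Proof. by split; [apply: mon1 | move=> c d; apply: mon0M]. Qed.
HB.instance Definition _ :=
  GRing.isZmodMorphism.Build K (fps K) mon_const mon_const_zmod.
HB.instance Definition _ :=
  GRing.isMonoidMorphism.Build K (fps K) mon_const mon_const_monoid.

(** The factorisation of X^l - 1, at y and with the roots inverted. *)
Lemma prod_root_factor (l : nat) (v : K) (y : fps K) : l.-primitive_root v ->
  \prod_(i < l) (1 - mon_const (v ^+ i) * y) = 1 - y ^+ l.
Proof.
move=> prim_v; have l_gt0 := prim_order_gt0 prim_v.
have vl1 := prim_expr_order prim_v.
have v0 : v != 0.
  apply/eqP => v0; have := vl1; rewrite v0 expr0n gtn_eqF // => /eqP.
  by rewrite eq_sym oner_eq0.
have prim_v' : l.-primitive_root v^-1.
  have -> : v^-1 = v ^+ l.-1.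
    by apply: (mulfI v0); rewrite divff // -exprS prednK.
  by rewrite prim_root_exp_coprime // coprime_sym -{1}(prednK l_gt0) coprimeSn.
have fac (u : K) : l.-primitive_root u ->
    \prod_(i < l) (y - mon_const (u ^+ i)) = y ^+ l - 1.
  move=> prim_u; have := factor_Xn_sub_1 prim_u.
  move=> /(congr1 (fun p => (map_poly mon_const p).[y])).
  rewrite big_mkord rmorph_prod horner_prod rmorphB rmorph1 /= map_polyXn !hornerE.
  move=> <-; apply: eq_bigr => i _; by rewrite map_polyXsubC hornerXsubC.
have cst : \prod_(i < l) (- v ^+ i) = - 1.
  have := congr1 (fun p => p.[0]) (factor_Xn_sub_1 prim_v).
  rewrite big_mkord horner_prod !hornerE expr0n gtn_eqF // sub0r => <-.
  by apply: eq_bigr => i _; rewrite hornerXsubC sub0r.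
transitivity (mon_const (\prod_(i < l) (- v ^+ i)) * (y ^+ l - 1)).
  rewrite -(fac _ prim_v') rmorph_prod -big_split /=; apply: eq_bigr => i _.
  rewrite mulrBr -rmorphM exprVn mulNr divff ?expf_neq0 // rmorphN1 rmorphN.
  by rewrite mulNr opprK addrC.
by rewrite cst rmorphN1 mulN1r opprB.
Qed.

Lemma prod_qprod_root (l : nat) (v c : K) : l.-primitive_root v -> c ^+ l = 1 ->
  \prod_(i < l) qprod (c * v ^+ i) 1 1 = qprod 1 l l.
Proof.
move=> prim_v cl1; have l_gt0 := prim_order_gt0 prim_v.
apply: fps_eqmP => N; apply: (@fps_eqmW _ _ N.+1) => //.
apply: (@fps_eqm_trans _ _ (\prod_(i < l) \prod_(n < N)
  (1 - mon (c * v ^+ i) (1 + 1 * n)%N%:Z))).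
  by apply: fps_eqm_prod => i; apply: qprod_eqm.
rewrite exchange_big; apply: fps_eqm_sym.
apply: fps_eqm_trans (qprod_eqm 1 N l_gt0 l_gt0) _; congr fps_trunc.
apply: eq_bigr => n _; rewrite mul1n add1n.
under eq_bigr => i _.
  rewrite (_ : mon _ _ = mon_const (v ^+ i) * mon c n.+1%:Z); last first.
    by rewrite monM // add0r mulrC.
  over.
by rewrite prod_root_factor // monX // cl1; congr (1 - mon _ _); lia.
Qed.

End RootOfUnity.

(** * Completing the multipliers modulo l *)

Section Complement.
Variables (K : numFieldType) (w : K).

(** The terms that complete k + 1 terms to a multiple of l, as k = - h modulo l. *)
Definition complement (h : nat) : fps K :=
  \prod_(j < h.-1) qprod (w ^ (h%:Z - 2 - (2 * j)%N%:Z)) 1 1.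

Lemma complementS h : (1 < h)%N -> complement h.+2 = complement h * qpair (w ^ h%:Z).
Proof.
move=> h1; rewrite /complement /= -(prednK (ltnW h1)) /= big_ord_recr big_ord_recl /=.
rewrite /qpair invr_expz mulrAC mulrC; congr (_ * (_ * _)).
- by apply: eq_bigr => j _; congr (qprod (w ^ _) 1 1); rewrite /bump /=; lia.
- by congr (qprod (w ^ _) 1 1); lia.
- by congr (qprod (w ^ _) 1 1); lia.
Qed.

Lemma complement2 : complement 2 = qprod 1 1 1.
Proof. by rewrite /complement big_ord1 /= expr0z. Qed.

End Complement.

Section Reduction.
Variable K : numFieldType.
Local Notation E := (qprod (1 : K) 1 1).
Variables (l : nat) (w : K).
Hypotheses (l_prime : prime l) (l_ge5 : (5 <= l)%N) (prim_w : l.-primitive_root w).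

Let wl1 : w ^+ l = 1. Proof. exact: prim_expr_order. Qed.
Let w0 : w != 0. Proof. exact: root1_neq0 wl1. Qed.
Let unit_E : E \is a GRing.unit. Proof. exact: qprod_unit. Qed.

Let expw_period n k : (l %| n - k)%Z -> w ^ n = w ^ k.
Proof. exact: expz_period. Qed.

Lemma crank_qpair a : gcrank w a * qpair (w ^ a) = E.
Proof. by rewrite -[RHS](gcrankE w a) /qpair invr_expz. Qed.

Lemma crank0_E : gcrank w 0 * E = 1.
Proof.
have := crank_qpair 0; rewrite expr0z qpair1 expr2 mulrA => e.
by apply: (mulIr unit_E); rewrite e mul1r.
Qed.

Lemma crank_multi_qpair k (a : nat -> int) :
  gcrank_multi w k a * \prod_(i < (k + odd k)./2) qpair (w ^ a i) = E ^+ odd k.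
Proof.
rewrite /gcrank_multi -mulrA -big_split /=.
under eq_bigr do rewrite crank_qpair.
rewrite prodr_const card_ord.
have -> : ((k + odd k)./2 = (k - odd k)./2 + odd k)%N by lia.
by rewrite exprD mulrA -exprMn crank0_E expr1n mul1r.
Qed.

(** The regular multipliers k, k - 2, ..., -k, extended to an arithmetic
    progression of n terms. *)
Definition progression (k n : nat) : fps K :=
  \prod_(i < n) qprod (w ^ (k%:Z - (2 * i)%N%:Z)) 1 1.

Lemma progression_pairs k :
  progression k k.+1 =
  E ^+ (~~ odd k) * \prod_(i < (k + odd k)./2) qpair (w ^ (k%:Z - (2 * i)%N%:Z)).
Proof.
set N := (k + odd k)./2.
have kE : k.+1 = (N + ~~ odd k + N)%N by rewrite /N; case: (boolP (odd k)); lia.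
rewrite /progression kE !big_split_ord /= mulrAC mulrC; congr (_ * _).
  case: (boolP (odd k)) => k_odd /=; first by rewrite big_ord0.
  rewrite big_ord1 /= addn0 expr1; congr (qprod _ 1 1).
  by rewrite (_ : _ - _ = 0) ?expr0z //; move: kE; rewrite k_odd /=; lia.
rewrite [X in _ * X](reindex_inj rev_ord_inj) -big_split /=; apply: eq_bigr => i _.
rewrite /qpair invr_expz; congr (_ * qprod (w ^ _) 1 1).
by have := ltn_ord i; lia.
Qed.

Lemma crank_progression k (a : nat -> int) : 
  (forall i, a i = k%:Z - (2 * i)%N%:Z) ->
  gcrank_multi w k a * progression k k.+1 = E.
Proof.
move=> aE; rewrite progression_pairs mulrCA.
under eq_bigr do rewrite -aE.
by rewrite crank_multi_qpair -exprD; case: (odd k).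
Qed.

Let prim_w2 : l.-primitive_root (w ^- 2).
Proof.
have -> : w ^- 2 = w ^+ (l - 2).
  by rewrite exprB ?unitfE // ?wl1 ?mul1r //; lia.
rewrite prim_root_exp_coprime // coprime_sym prime_coprime // gtnNdvd //; lia.
Qed.

(** Since l is odd, each block of l consecutive terms runs over all the residue
    classes modulo l. *)
Lemma progression_full k t : progression k (l * t) = qprod 1 l l ^+ t.
Proof.
elim: t => [|t IHt]; first by rewrite muln0 /progression big_ord0.
rewrite mulnSr /progression big_split_ord /= -/(progression _ _) IHt exprSr.
congr (_ * _); rewrite -(@prod_qprod_root _ l (w ^- 2) (w ^ k%:Z)) //; last first.
  by rewrite -exprnP -exprM mulnC exprM wl1 expr1n.
apply: eq_bigr => i _; congr (qprod _ 1 1).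
rewrite -exprVn -exprM exprVn exprnN -expfzDr //; apply: expw_period.
by apply/dvdzP; exists (- (2 * t)%N%:Z); lia.
Qed.

Lemma progression_complement k h t : (0 < h)%N -> (k + h = l * t)%N ->
  progression k k.+1 * complement w h = qprod 1 l l ^+ t.
Proof.
move=> h0 kh; rewrite -(progression_full k t) -kh.
have -> : (k + h = k.+1 + h.-1)%N by lia.
rewrite /progression big_split_ord /=; congr (_ * _).
apply: eq_bigr => j _; congr (qprod _ 1 1); apply: expw_period.
by apply/dvdzP; exists t%:Z; lia.
Qed.

(** The complement supplies the missing residue classes, and the full product is a
    series in q^l. *)
Lemma crank_standard k h t : (0 < h)%N -> (k + h = l * t)%N ->
  ~~ has_odd_prime_2mod3 (k + 14) ->
  gcrank_k w k * qprod 1 l l ^+ t = E * complement w h.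
Proof.
move=> h0 kh not_exc; rewrite -(progression_complement h0 kh) mulrA.
by rewrite crank_progression // => i; rewrite /crank_mult (negPf not_exc) andbF.
Qed.

(** Modulo l, exchanging k for k + 2 in the denominator exchanges h for h + 2 in
    the complement. *)
Lemma crank_exceptional k h t : (0 < k)%N -> (1 < h)%N -> (k + h.+2 = l * t)%N ->
  has_odd_prime_2mod3 (k + 14) ->
  gcrank_k w k * qprod 1 l l ^+ t = E * complement w h * qpair (w ^+ h.+2).
Proof.
move=> k0 h1 kh exc; rewrite [w ^+ h.+2]exprnP.
pose a i := k%:Z - (2 * i)%N%:Z.
have swap : gcrank_k w k * qpair (w ^ (k%:Z + 2)) =
    gcrank_multi w k a * qpair (w ^ k%:Z).
  have N_gt0 : (0 < (k + odd k)./2)%N by lia.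
  rewrite /gcrank_k /gcrank_multi; move: N_gt0; case: (k + odd k)./2 => // N _.
  rewrite !big_ord_recl /crank_mult exc /= /a muln0 subr0.
  set T := \prod_(i < N) _.
  rewrite -!mulrA [T * _]mulrC [gcrank w (k%:Z + 2) * _]mulrA crank_qpair.
  by rewrite [T * _]mulrC [gcrank w k%:Z * _]mulrA crank_qpair.
have pair1 : qpair (w ^ (k%:Z + 2)) = qpair (w ^ h%:Z).
  rewrite -[RHS]qpairV invr_expz; congr qpair; apply: expw_period.
  by apply/dvdzP; exists t%:Z; lia.
have pair2 : qpair (w ^ k%:Z) = qpair (w ^ h.+2%:Z).
  rewrite -[RHS]qpairV invr_expz; congr qpair; apply: expw_period.
  by apply/dvdzP; exists t%:Z; lia.
apply: (mulIr (qpair_unit (w ^ h%:Z))).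
rewrite -(progression_complement (ltn0Sn _) kh) complementS //.
rewrite mulrAC -{1}pair1 swap pair2.
have := @crank_progression k a (fun i => erefl) => e.
transitivity (gcrank_multi w k a * progression k k.+1 *
  (complement w h * qpair (w ^ h%:Z) * qpair (w ^ h.+2%:Z))); first by ring.
rewrite e; ring.
Qed.

End Reduction.

(** * Removing the series in the l-th power of q *)

Section Lacunary.
Variables (R : comUnitRingType) (l : nat).

Definition lacunary (f : fps R) : Prop := forall i, ~~ (l %| i)%N -> fps_coef f i = 0.

Lemma lacunary1 : lacunary 1.
Proof. by case=> [|i] //; rewrite dvdn0. Qed.

Lemma lacunaryM f g : lacunary f -> lacunary g -> lacunary (f * g).
Proof.
move=> lac_f lac_g m l_m; rewrite fps_coefM big1 // => i _.
have [l_i|/lac_f->] := boolP (l %| i)%N; last by rewrite mul0r.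
rewrite lac_g ?mulr0 //; apply: contra l_m => l_mi.
by rewrite -(@subnK i m) ?dvdn_add // -ltnS.
Qed.

Lemma lacunaryX f n : lacunary f -> lacunary (f ^+ n).
Proof.
move=> lac_f; elim: n => [|n IHn]; first exact: lacunary1.
by rewrite exprS; apply: lacunaryM.
Qed.

Lemma lacunary_qprod : (0 < l)%N -> lacunary (qprod 1 l l).
Proof.
move=> l0 i l_i; rewrite (fps_eqm_coef (qprod_eqm 1 i l0 l0)) //.
move: i l_i => i.
suff /(_ i) : lacunary (\prod_(j < i) (1 - mon 1 (l + l * j)%N%:Z)) by [].
elim/big_rec: _ => [|j f _ lac_f]; first exact: lacunary1.
apply: lacunaryM => // m l_m; rewrite fps_coefD fps_coefN lacunary1 // coef_mon.
rewrite ifN ?subr0 //; apply: contra l_m => /eqP[<-].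
by rewrite -mulnS dvdn_mulr.
Qed.

(** Dividing by a series in q^l acts separately on each class of exponents
    modulo l. *)
Lemma lacunary_quotient f g r :
  lacunary g -> fps_coef g 0 = 1 ->
  (forall m, (m %% l = r)%N -> fps_coef (f * g) m = 0) ->
  forall m, (m %% l = r)%N -> fps_coef f m = 0.
Proof.
move=> lac_g g0 fg0; elim/ltn_ind => m IHm m_r.
have := fg0 m m_r; rewrite fps_coefM big_ord_recr /= subnn g0 mulr1 big1 ?add0r //.
move=> i _; have [l_mi|/lac_g->] := boolP (l %| m - i)%N; last by rewrite mulr0.
rewrite IHm ?mul0r //; apply/eqP; rewrite -m_r eq_sym eqn_mod_dvd //.
exact: ltnW.
Qed.

End Lacunary.

(** * The crank at a root of unity *)

Section RootVanishing.
Variable K : numFieldType.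
Local Notation E := (qprod (1 : K) 1 1).
Variables (l : nat) (w : K).
Hypotheses (l_prime : prime l) (l_ge5 : (5 <= l)%N) (prim_w : l.-primitive_root w).

Let root_w i : (w ^+ i) ^+ l = 1.
Proof. by rewrite exprAC (prim_expr_order prim_w) expr1n. Qed.

Let w_neq1 i : ~~ (l %| i)%N -> w ^+ i != 1.
Proof. by rewrite (prim_order_dvd prim_w). Qed.

Let ndvd i : (0 < i < l)%N -> ~~ (l %| i)%N.
Proof. by case/andP=> i0 lt_il; rewrite gtnNdvd. Qed.

Let ndvd2 i : ~~ (l %| i)%N -> ~~ (l %| 2 * i)%N.
Proof. by move=> l_i; rewrite Euclid_dvdM // negb_or l_i andbT ndvd //; lia. Qed.

Let comp2 := complement2 w.
Let comp4 : complement w 4 = E * qpair (w ^+ 2).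
Proof. by rewrite complementS // comp2. Qed.
Let comp6 : complement w 6 = E * qpair (w ^+ 2) * qpair (w ^+ 4).
Proof. by rewrite complementS // comp4. Qed.
Let comp8 : complement w 8 = E * qpair (w ^+ 2) * qpair (w ^+ 4) * qpair (w ^+ 6).
Proof. by rewrite complementS // comp6. Qed.
Let comp10 : complement w 10 =
  E * qpair (w ^+ 2) * qpair (w ^+ 4) * qpair (w ^+ 6) * qpair (w ^+ 8).
Proof. by rewrite complementS // comp8. Qed.
Let comp12 : complement w 12 =
  E * qpair (w ^+ 2) * qpair (w ^+ 4) * qpair (w ^+ 6) *
  qpair (w ^+ 8) * qpair (w ^+ 10).
Proof. by rewrite complementS // comp10. Qed.

Variable k : nat.
Hypothesis k_gt0 : (0 < k)%N.

Definition block_vanishes h t : Prop := forall m, (l %| 24 * m + h)%N ->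
  fps_coef (gcrank_k w k * qprod 1 l l ^+ t) m = 0.

Lemma block_h4 t : (k + 4 = l * t)%N -> (l %% 3 = 2)%N -> block_vanishes 4 t.
Proof.
move=> kt l3 m l_m; have [exc|not_exc] := boolP (has_odd_prime_2mod3 (k + 14)).
  rewrite (crank_exceptional l_prime l_ge5 prim_w k_gt0 _ kt exc) // comp2.
  by rewrite -expr2; apply: (coef_block4 l_prime l_ge5) => //; apply/w_neq1/ndvd; lia.
rewrite (crank_standard l_prime l_ge5 prim_w _ kt not_exc) // comp4 mulrA -expr2.
by apply: (coef_block4 l_prime l_ge5) => //; apply/w_neq1/ndvd; lia.
Qed.

Lemma block_h6 t : (k + 6 = l * t)%N -> (l %% 4 = 3)%N -> block_vanishes 6 t.
Proof.
move=> kt l4 m l_m; have [exc|not_exc] := boolP (has_odd_prime_2mod3 (k + 14)).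
  rewrite (crank_exceptional l_prime l_ge5 prim_w k_gt0 _ kt exc) // comp4.
  rewrite (_ : E * _ * _ = E ^+ 2 * (qpair (w ^+ 2) * qpair (w ^+ 6))); last by ring.
  by apply: (coef_block6 l_prime l_ge5) => //; apply/w_neq1/ndvd; lia.
rewrite (crank_standard l_prime l_ge5 prim_w _ kt not_exc) // comp6.
rewrite (_ : E * _ = E ^+ 2 * (qpair (w ^+ 2) * qpair (w ^+ 4))); last by ring.
by apply: (coef_block6 l_prime l_ge5) => //; apply/w_neq1/ndvd; lia.
Qed.

(** The multipliers 1, 2, 3 are those of A2. *)
Lemma block_h8 t : (k + 8 = l * t)%N -> (l %% 3 = 2)%N ->
  ~~ has_odd_prime_2mod3 (k + 14) -> block_vanishes 8 t.
Proof.
move=> kt l3 not_exc m l_m.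
rewrite (crank_standard l_prime l_ge5 prim_w _ kt not_exc) // comp8.
have -> : w ^+ 6 = w ^+ 2 * w ^+ 4 by rewrite -exprD.
rewrite (_ : E * _ = E ^+ 2 * (qpair (w ^+ 2) * qpair (w ^+ 4) *
  qpair (w ^+ 2 * w ^+ 4))); last by ring.
apply: (coef_block8 l_prime l_ge5) => //; rewrite -?exprD; apply/w_neq1.
- by apply: ndvd; lia.
- by apply: ndvd; lia.
by apply: (@ndvd2 3); apply: ndvd; lia.
Qed.

(** Both {1, 2, 3, 4} and {1, 2, 3, 5} are of the form {x, y, x + y, x - y}, at
    (3, 1) and (3, 2). *)
Lemma block_h10 t : (k + 10 = l * t)%N -> (l %% 4 = 3)%N -> block_vanishes 10 t.
Proof.
move=> kt l4 m l_m; have l_ge7 : (7 <= l)%N by lia.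
have w0 : w != 0 by apply: root1_neq0 (prim_expr_order prim_w).
have w62 : w ^+ 6 / w ^+ 2 = w ^+ 4 by rewrite (exprD w 4 2) mulfK ?expf_neq0.
have w64 : w ^+ 6 / w ^+ 4 = w ^+ 2 by rewrite (exprD w 2 4) mulfK ?expf_neq0.
have [exc|not_exc] := boolP (has_odd_prime_2mod3 (k + 14)).
  rewrite (crank_exceptional l_prime l_ge5 prim_w k_gt0 _ kt exc) // comp8.
  rewrite (_ : E * _ * _ = E ^+ 2 * (qpair (w ^+ 6) * qpair (w ^+ 4) *
    (qpair (w ^+ 6 * w ^+ 4) * qpair (w ^+ 6 / w ^+ 4)))); last first.
    by rewrite w64 -exprD; ring.
  apply: (coef_block10 l_prime l_ge5) => //; rewrite ?w64 -?exprD; apply/w_neq1.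
  - by apply: ndvd; lia.
  - by apply: ndvd; lia.
  - by apply: (@ndvd2 5); apply: ndvd; lia.
  - by apply: ndvd; lia.
rewrite (crank_standard l_prime l_ge5 prim_w _ kt not_exc) // comp10.
rewrite (_ : E * _ = E ^+ 2 * (qpair (w ^+ 6) * qpair (w ^+ 2) *
  (qpair (w ^+ 6 * w ^+ 2) * qpair (w ^+ 6 / w ^+ 2)))); last first.
  by rewrite w62 -exprD; ring.
apply: (coef_block10 l_prime l_ge5) => //; rewrite ?w62 -?exprD; apply/w_neq1.
- by apply: ndvd; lia.
- by apply: ndvd; lia.
- by apply: (@ndvd2 4); apply: ndvd; lia.
- by apply: ndvd; lia.
Qed.

(** The exceptional multipliers are those of the roots of G2: {1, 2, 3, 4, 5, 7}
    instead of {1, ..., 6}. *)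
Lemma block_h14 t : (k + 14 = l * t)%N -> (l %% 3 = 2)%N -> (5 < l)%N ->
  has_odd_prime_2mod3 (k + 14) -> block_vanishes 14 t.
Proof.
move=> kt l3 l_gt5 exc m l_m; have l_gt7 : (7 < l)%N.
  have : ~~ prime 6 by [].
  by have := l_prime; case: (l =P 6%N) => [->//|]; lia.
have w0 : w != 0 by apply: root1_neq0 (prim_expr_order prim_w).
have e8 : w ^+ 2 * w ^+ 6 = w ^+ 8 by rewrite -exprD.
have e4 : w ^+ 6 / w ^+ 2 = w ^+ 4 by rewrite (exprD w 4 2) mulfK ?expf_neq0.
have e10 : (w ^+ 2) ^+ 2 * w ^+ 6 = w ^+ 10 by rewrite -exprM -exprD.
have e14 : w ^+ 2 * (w ^+ 6) ^+ 2 = w ^+ 14 by rewrite -exprM -exprD.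
rewrite (crank_exceptional l_prime l_ge5 prim_w k_gt0 _ kt exc) // comp12.
rewrite (_ : E * _ * _ = E ^+ 2 * (qpair (w ^+ 2) * qpair (w ^+ 6) *
  qpair (w ^+ 2 * w ^+ 6) * (qpair (w ^+ 6 / w ^+ 2) *
  qpair ((w ^+ 2) ^+ 2 * w ^+ 6) * qpair (w ^+ 2 * (w ^+ 6) ^+ 2)))); last first.
  by rewrite e8 e4 e10 e14; ring.
apply: (coef_block14 l_prime l_ge5) => //; rewrite ?e8 ?e4 ?e10 ?e14; apply/w_neq1.
- by apply: ndvd; lia.
- by apply: ndvd; lia.
- by apply: (@ndvd2 4); apply: ndvd; lia.
- by apply: ndvd; lia.
- by apply: (@ndvd2 5); apply: ndvd; lia.
- by apply: (@ndvd2 7); apply: ndvd; lia.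
Qed.

Lemma coef_crank_root (delta n : nat)
  (hyp : exists h t : nat,
    [/\ (0 < h)%N, (0 < t)%N, (k + h = l * t)%N &
      [\/ (h \in [:: 4; 8; 14])%N /\ (l %% 3 = 2)%N,
          (h \in [:: 6; 10])%N /\ (l %% 4 = 3)%N
        | (h = 26)%N /\ (l %% 12 = 11)%N]])
  (delta_lt : (delta < l)%N) (delta_def : (24 * delta = k %[mod l])%N)
  (cond_i : [\/ ~~ has_odd_prime_2mod3 (k + 14),
                (l %% 3)%N <> 2 | ~~ (l %| k + 8)%N])
  (cond_ii : (l %% 12)%N <> 11 \/ ~~ (l %| k + 26)%N) :
  fps_coef (gcrank_k w k) (l * n + delta) = 0.
Proof.
have l_gt0 : (0 < l)%N by lia.
have [h [t [kh vanish]]] : exists h t, (k + h = l * t)%N /\ block_vanishes h t.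
  have [h [t [_ t0 kh hl]]] := hyp.
  have l_dvd : (l %| k + h)%N by rewrite kh dvdn_mulr.
  case: hl => [[]|[]|[hE l12]].
  - rewrite !inE => /or3P[]/eqP hE l3; move: kh l_dvd; rewrite hE => kh l_dvd.
    + by exists 4%N, t; split=> //; apply: block_h4.
    + exists 8%N, t; split=> //; apply: block_h8 => //.
      by case: cond_i => // ; rewrite l_dvd.
    have [l5|l_neq5] := eqVneq l 5%N.
      (* 14 = 4 modulo 5, and the order 5 would kill one of the factors 1 - x *)
      exists 4%N, (t - 2)%N; have kh4 : (k + 4 = l * (t - 2))%N by rewrite l5; lia.
      by split=> //; apply: block_h4.
    exists 14%N, t; split=> //; apply: block_h14 => //; first by lia.
    apply/hasP; exists l; first by rewrite mem_primes l_prime l_dvd addn_gt0 orbT.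
    by rewrite l3 eqxx andbT; have := even_prime l_prime; lia.
  - rewrite !inE => /orP[]/eqP hE l4; move: kh; rewrite hE => kh.
      by exists 6%N, t; split=> //; apply: block_h6.
    by exists 10%N, t; split=> //; apply: block_h10.
  by case: cond_ii => [|/negP[]]; [rewrite l12 | rewrite -hE].
apply: (@lacunary_quotient _ l _ (qprod 1 l l ^+ t) delta).
- exact/lacunaryX/lacunary_qprod.
- by rewrite fps_coef0X qprod_coef0 // expr1n.
- move=> m m_delta; apply: vanish; rewrite /dvdn -modnDml.
  by rewrite -modnMmr m_delta delta_def modnDml kh modnMr.
by rewrite mulnC modnMDl modn_small.
Qed.

End RootVanishing.

(** * Evaluation of Laurent polynomials *)

Section Evaluation.
Variables (K : numFieldType) (w : K).
Hypothesis w0 : w != 0.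

Lemma zeta_neq0 : zeta != 0.
Proof. by rewrite tofrac_eq0 polyX_eq0. Qed.

Definition int_eval (p : {poly int}) : K := (map_poly intr p).[w].

Lemma int_evalD p r : int_eval (p + r) = int_eval p + int_eval r.
Proof. by rewrite /int_eval rmorphD hornerD. Qed.
Lemma int_evalM p r : int_eval (p * r) = int_eval p * int_eval r.
Proof. by rewrite /int_eval rmorphM hornerM. Qed.
Lemma int_evalXn n : int_eval 'X^n = w ^+ n.
Proof. by rewrite /int_eval map_polyXn hornerXn. Qed.
Lemma int_evalN p : int_eval (- p) = - int_eval p.
Proof. by rewrite /int_eval rmorphN hornerN. Qed.
Lemma int_eval1 : int_eval 1 = 1.
Proof. by rewrite /int_eval rmorph1 hornerE. Qed.

(** A relation instead of a function: no reduced numerator has to be chosen, and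
    compatibility with the ring operations is immediate. That the value 0 does
    not depend on the fraction is evaluates_is0. *)
Definition evaluates (f : ratfun) (v : K) : Prop :=
  exists p n, f = tofrac p / zeta ^+ n /\ v = int_eval p / w ^+ n.

Lemma evaluates_is0 f p n :
  evaluates f 0 -> f = tofrac p / zeta ^+ n -> int_eval p = 0.
Proof.
case=> r [m [-> v0]] e; have z0 j : zeta ^+ j != 0 by rewrite expf_neq0 ?zeta_neq0.
have w_neq0 j : w ^+ j != 0 by rewrite expf_neq0.
have r0 : int_eval r = 0.
  by apply/eqP; move/esym/eqP: v0; rewrite mulf_eq0 invr_eq0 (negPf (w_neq0 m)) orbF.
have : tofrac (r * 'X^n) = tofrac (p * 'X^m).
  rewrite !tofracM !tofracXn -/zeta.
  by move/eqP: e; rewrite eqr_div // => /eqP.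
move/eqP; rewrite tofrac_eq => /eqP/(congr1 int_eval).
rewrite !int_evalM !int_evalXn r0 mul0r => /esym/eqP.
by rewrite mulf_eq0 (negPf (w_neq0 m)) orbF => /eqP.
Qed.

Lemma evaluatesD f g u v :
  evaluates f u -> evaluates g v -> evaluates (f + g) (u + v).
Proof.
move=> [p [m [-> ->]]] [r [n [-> ->]]].
exists (p * 'X^n + r * 'X^m), (m + n)%N.
rewrite tofracD !tofracM !tofracXn -/zeta int_evalD !int_evalM !int_evalXn.
by rewrite !exprD !addf_div ?expf_neq0 ?zeta_neq0.
Qed.

Lemma evaluatesM f g u v :
  evaluates f u -> evaluates g v -> evaluates (f * g) (u * v).
Proof.
move=> [p [m [-> ->]]] [r [n [-> ->]]]; exists (p * r), (m + n)%N.
by rewrite tofracM int_evalM !exprD !mulf_div.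
Qed.

Lemma evaluatesN f u : evaluates f u -> evaluates (- f) (- u).
Proof.
by move=> [p [m [-> ->]]]; exists (- p), m; rewrite tofracN int_evalN !mulNr.
Qed.

Lemma evaluates1 : evaluates 1 1.
Proof. by exists 1, 0%N; rewrite tofrac1 int_eval1 !expr0 !divr1. Qed.

Lemma evaluates0 : evaluates 0 0.
Proof. by have := evaluatesD evaluates1 (evaluatesN evaluates1); rewrite !subrr. Qed.

Lemma evaluates_bool (b : bool) : evaluates b%:R b%:R.
Proof. by case: b; [apply: evaluates1 | apply: evaluates0]. Qed.

Lemma evaluates_zeta (a : int) : evaluates (zeta ^ a) (w ^ a).
Proof.
case: a => n; first by exists 'X^n, 0%N; rewrite tofracXn int_evalXn !expr0 !divr1.
by exists 1, n.+1; rewrite tofrac1 int_eval1 !mul1r.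
Qed.

Lemma evaluates_sum (I : Type) (r : seq I) (F : I -> ratfun) (G : I -> K) :
  (forall i, evaluates (F i) (G i)) ->
  evaluates (\sum_(i <- r) F i) (\sum_(i <- r) G i).
Proof.
move=> FG; elim/big_rec2: _ => [|i y x _]; first exact: evaluates0.
exact: evaluatesD.
Qed.

Definition fps_evaluates (f : fps ratfun) (g : fps K) : Prop :=
  forall m, evaluates (fps_coef f m) (fps_coef g m).

Lemma fps_evaluates1 : fps_evaluates 1 1.
Proof. by move=> m; rewrite !fps_coef1; apply: evaluates_bool. Qed.

Lemma fps_evaluatesM f g u v :
  fps_evaluates f u -> fps_evaluates g v -> fps_evaluates (f * g) (u * v).
Proof.
by move=> fu gv m; rewrite !fps_coefM; apply: evaluates_sum => i; apply: evaluatesM.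
Qed.

Lemma fps_evaluatesB f g u v :
  fps_evaluates f u -> fps_evaluates g v -> fps_evaluates (f - g) (u - v).
Proof.
move=> fu gv m; rewrite !fps_coefD !fps_coefN.
by apply: evaluatesD => //; apply: evaluatesN.
Qed.

Lemma fps_evaluatesX f u n : fps_evaluates f u -> fps_evaluates (f ^+ n) (u ^+ n).
Proof.
move=> fu; elim: n => [|n IHn]; first exact: fps_evaluates1.
by rewrite !exprS; apply: fps_evaluatesM.
Qed.

Lemma fps_evaluates_prod (I : Type) (r : seq I)
    (F : I -> fps ratfun) (G : I -> fps K) :
  (forall i, fps_evaluates (F i) (G i)) ->
  fps_evaluates (\prod_(i <- r) F i) (\prod_(i <- r) G i).
Proof.
move=> FG; elim/big_rec2: _ => [|i y x _]; first exact: fps_evaluates1.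
exact: fps_evaluatesM.
Qed.

Lemma fps_evaluates_q : fps_evaluates (fps_q ratfun) (fps_q K).
Proof. by move=> m; apply: evaluates_bool. Qed.

Lemma fps_evaluates_const c d :
  evaluates c d -> fps_evaluates (fps_const c) (fps_const d).
Proof. by move=> cd [|m]; [apply: cd | apply: evaluates0]. Qed.

(** The coefficients of an inverse are polynomials in those of the series when
    the constant term is 1. *)
Lemma fps_evaluatesV f u : fps_coef f 0 = 1 -> fps_coef u 0 = 1 ->
  fps_evaluates f u -> fps_evaluates f^-1 u^-1.
Proof.
have rec (R : comUnitRingType) (g : fps R) m : fps_coef g 0 = 1 -> fps_coef g^-1 m =
    (m == 0)%N%:R - \sum_(i < m) fps_coef g^-1 i * fps_coef g (m - i)%N.
  move=> g0; rewrite -(fps_coef1 R) -(mulVr (fps_unit1 g0)) fps_coefM.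
  by rewrite big_ord_recr /= subnn g0 mulr1 [in RHS]addrAC subrr add0r.
move=> f0 u0 fu; elim/ltn_ind => m IHm; rewrite !rec //.
apply: evaluatesD; first exact: evaluates_bool.
apply: evaluatesN; elim/big_rec2: _ => [|i y x _]; first exact: evaluates0.
by apply: evaluatesD; apply: evaluatesM => //; apply: IHm.
Qed.

Lemma fps_evaluates_infprod (F : nat -> fps ratfun) (G : nat -> fps K) :
  (forall n, (0 < n)%N -> fps_evaluates (F n) (G n)) ->
  fps_evaluates (fps_infprod F) (fps_infprod G).
Proof.
move=> FG m; suff : fps_evaluates (\prod_(1 <= n < m.+1) F n)
  (\prod_(1 <= n < m.+1) G n).
  by apply.
rewrite !big_add1 /=; rewrite !big_mkord.
by apply: fps_evaluates_prod => i; apply: FG.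
Qed.

Lemma fps_evaluates_crank a : fps_evaluates (gcrank zeta a) (gcrank w a).
Proof.
have evX n c d : evaluates c d ->
    fps_evaluates (1 - fps_const c * fps_q ratfun ^+ n)
      (1 - fps_const d * fps_q K ^+ n).
  move=> cd; apply: fps_evaluatesB; first exact: fps_evaluates1.
  apply: fps_evaluatesM; first exact: fps_evaluates_const.
  exact/fps_evaluatesX/fps_evaluates_q.
apply: fps_evaluates_infprod => n n_gt0; apply: fps_evaluatesM.
  apply: fps_evaluatesB; first exact: fps_evaluates1.
  exact/fps_evaluatesX/fps_evaluates_q.
apply: fps_evaluatesV.
- by rewrite fps_coef0M !(@one_upto_factor _ _ n 0) ?mulr1.
- by rewrite fps_coef0M !(@one_upto_factor _ _ n 0) ?mulr1.
by apply: fps_evaluatesM; apply: evX; apply: evaluates_zeta.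
Qed.

Lemma fps_evaluates_crank_k k : fps_evaluates (gcrank_k zeta k) (gcrank_k w k).
Proof.
apply: fps_evaluatesM; first exact/fps_evaluatesX/fps_evaluates_crank.
by apply: fps_evaluates_prod => i; apply: fps_evaluates_crank.
Qed.

End Evaluation.

Definition Phi_poly (l : nat) : {poly int} := \poly_(i < l) 1.

Lemma size_Phi_poly l : (0 < l)%N -> size (Phi_poly l) = l.
Proof. by case: l => // l _; rewrite size_poly_eq. Qed.

Lemma Phi_poly_monic l : (0 < l)%N -> Phi_poly l \is monic.
Proof.
move=> l0; rewrite monicE lead_coefE size_Phi_poly // coef_poly.
by rewrite prednK // leqnn.
Qed.

Lemma tofrac_Phi l : tofrac (Phi_poly l) = Phi l zeta.
Proof.
rewrite /Phi_poly poly_def rmorph_sum; apply: eq_bigr => i _.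
by rewrite scale1r /= tofracXn.
Qed.

(** An integer polynomial that vanishes at all the roots of unity of prime order
    l is a multiple of the l-th cyclotomic polynomial: the remainder has l - 1
    roots and degree less than l - 1. *)
Lemma Phi_dvd l (p : {poly int}) : prime l ->
  (forall w : algC, l.-primitive_root w -> int_eval w p = 0) ->
  exists r, p = r * Phi_poly l.
Proof.
move=> l_pr p0; have l_gt0 := prime_gt0 l_pr.
have monPhi := Phi_poly_monic l_gt0.
have p_eq := Pdiv.RingMonic.rdivp_eq monPhi p.
set r := Pdiv.Ring.rmodp p (Phi_poly l) in p_eq.
have size_r : (size r < l)%N.
  by rewrite -[X in (_ < X)%N](size_Phi_poly l_gt0) Pdiv.Ring.ltn_rmodp monic_neq0.
have [w prim_w] := C_prim_root_exists l_gt0.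
have prim_wX i : (0 < i < l)%N -> l.-primitive_root (w ^+ i).
  case/andP=> i0 lt_il.
  by rewrite prim_root_exp_coprime // coprime_sym prime_coprime // gtnNdvd.
have r0 (v : algC) : l.-primitive_root v -> int_eval v r = 0.
  move=> prim_v; have := p0 v prim_v; rewrite p_eq int_evalD int_evalM.
  suff -> : int_eval v (Phi_poly l) = 0 by rewrite mulr0 add0r.
  have v1 : v - 1 != 0.
    by rewrite subr_eq0 -[v]expr1 -(prim_order_dvd prim_v) gtnNdvd ?prime_gt1.
  apply: (mulfI v1); rewrite mulr0 /int_eval /Phi_poly poly_def rmorph_sum horner_sum.
  under eq_bigr do rewrite scale1r /= map_polyXn hornerXn.
  by rewrite -subrX1 prim_expr_order // subrr.
suff r_eq0 : r = 0.
  by exists (Pdiv.Ring.rdivp p (Phi_poly l)); rewrite {1}p_eq r_eq0 addr0.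
apply/eqP; apply: contraT => r_neq0.
have inj_intr : injective (intr : int -> algC) by apply: intr_inj.
pose rs := [seq w ^+ i | i <- iota 1 l.-1].
have r'_neq0 : map_poly (intr : int -> algC) r != 0.
  by rewrite map_poly_eq0_id0 // intr_eq0 lead_coef_eq0.
have := max_poly_roots r'_neq0 (_ : all (root _) rs) (_ : uniq rs).
rewrite size_map size_iota size_map_inj_poly ?rmorph0 // => bound.
suff: (l.-1 < size r)%N by move: size_r; lia.
apply: bound.
  apply/allP => _ /mapP[i i_l ->]; apply/eqP/r0/prim_wX.
  by move: i_l; rewrite mem_iota; lia.
rewrite map_inj_in_uniq ?iota_uniq // => i j; rewrite !mem_iota => i_l j_l /eqP.
by rewrite (eq_prim_root_expr prim_w) !modn_small; [move/eqP| lia | lia].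
Qed.

Close Scope ring_scope.

Theorem theorem1p3 (k l delta : nat)
  (k_ge1 : (1 <= k)%N) (l_prime : prime l) (l_ge5 : (5 <= l)%N)
  (hyp : exists h t : nat,
    [/\ (0 < h)%N, (0 < t)%N, (k + h = l * t)%N &
      [\/ (h \in [:: 4; 8; 14]) /\ (l %% 3 = 2)%N,
          (h \in [:: 6; 10]) /\ (l %% 4 = 3)%N
        | (h = 26) /\ (l %% 12 = 11)%N]])
  (delta_lt : (delta < l)%N) (delta_def : (24 * delta = k %[mod l])%N)
  (cond_i : [\/ ~~ has_odd_prime_2mod3 (k + 14),
                (l %% 3)%N <> 2 | ~~ (l %| k + 8)%N])
  (cond_ii : (l %% 12)%N <> 11 \/ ~~ (l %| k + 26)%N)
  (n : nat) :
  laurent_dvd (Phi l zeta) (fps_coef (crank_k k) (l * n + delta)).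
Proof.
rewrite crank_kE; set f := fps_coef _ _.
have f0 (w : algC) : (l.-primitive_root w)%R -> evaluates w f 0%R.
  move=> prim_w; have w0 : (w != 0)%R by apply: root1_neq0 (prim_expr_order prim_w).
  rewrite -(coef_crank_root l_prime l_ge5 prim_w k_ge1 n hyp delta_lt delta_def
    cond_i cond_ii).
  exact: fps_evaluates_crank_k.
have [w prim_w] := C_prim_root_exists (prime_gt0 l_prime).
have [p [m [fE _]]] := f0 w prim_w.
have [r pE] : exists r, p = (r * Phi_poly l)%R.
  apply: Phi_dvd => // v prim_v.
  have v0 : (v != 0)%R by apply: root1_neq0 (prim_expr_order prim_v).
  exact: evaluates_is0 v0 _ _ _ (f0 v prim_v) fE.
exists (tofrac r / zeta ^+ m)%R; first by exists r, m.
by rewrite fE pE tofracM tofrac_Phi [RHS]mulrCA mulrA.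
Qed.
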